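(* Let $K$ be an infinite field of characteristic different from $2$ and $3$, let $n\ge 3$, and let $f=f(x,y,z)\in F_3$ be an element of the free unital associative $K$-algebra on $x,y,z$. Then the identity $f(x,y,z)=0$ holds in the algebra $F^{(n)}$ (equivalently, $f\in T^{(n)}$) if and only if $\mathrm{wt}(f)\ge n$.
   Context: Commutators: $[a_1,a_2]=a_1a_2-a_2a_1$ and $[a_1,\dots,a_n]=[[a_1,\dots,a_{n-1}],a_n]$. $F$ is the free unital associative $K$-algebra on $X=\{x_1,x_2,\dots\}$; $F_3$ is its unital subalgebra generated by $X_3=\{x_1,x_2,x_3\}=\{x,y,z\}$. $T^{(n)}$ is the two-sided ideal of $F$ generated by all $[a_1,\dots,a_n]$, $a_i\in F$ (the T-ideal generated by $[x_1,\dots,x_n]$), and $F^{(n)}=F/T^{(n)}$. Weight. Let $L_3\subset F_3$ be the free Lie algebra on $X_3$ (the Lie subalgebra of $F_3$ generated by $X_3$ under the commutator). Fix a $K$-basis $\{e_\alpha\}$ of $L_3$ consisting of homogeneous elements, totally ordered in such a way that $e_\alpha<e_\beta$ whenever $\deg e_\alpha>\deg e_\beta$. By the Poincaré–Birkhoff–Witt theorem the regular words $v=e_{i_1}e_{i_2}\cdots e_{i_t}$ with $e_{i_1}\le\dots\le e_{i_t}$ (product taken in $F_3$; the empty word $1$, with $t=0$, included) form a $K$-basis of $F_3$. The weight of a regular word is $$\mathrm{wt}(v)=\sum_{j=1}^t\deg(e_{i_j})-t+1 .$$ The weight $\mathrm{wt}(a)$ of a nonzero element $a=\sum_i\alpha_iv_i$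 ($0\ne\alpha_i\in K$, $v_i$ distinct regular words) is the minimum of the weights $\mathrm{wt}(v_i)$; by convention $\mathrm{wt}(0)=+\infty$. *)

(* Defs.v *)
From HB Require Import structures.
From mathcomp Require Import all_boot all_order all_algebra ring_quotient.
From mathcomp Require Import finmap.
From mathcomp.multinomials Require Import monalg.
From mathcomp Require Import boolp classical_sets cardinality.
From mathcomp Require Import constructive_ereal.

Set Implicit Arguments.
Unset Strict Implicit.
Unset Printing Implicit Defensive.

Import Order.TTheory GRing.Theory Num.Theory.
Local Open Scope classical_set_scope.
Local Open Scope quotient_scope.
Local Open Scope ring_scope.

Section Commutators.
Variable R : pzRingType.

Definition commr (a b : R) : R := a * b - b * a.

(* [a_1, ..., a_n], left-normed; the value on the empty sequence is junk *)
Definition lcommr (s : seq R) : R :=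
  if s is a :: s' then foldl commr a s' else 0.

Definition ideal_closed (S : set R) : Prop :=
  GRing.zmod_closed [in S] /\ forall a x b : R, S x -> S (a * x * b).

Definition ideal_gen (G : set R) : set R := smallest ideal_closed G.

Lemma ideal_gen_closed (G : set R) : ideal_closed (ideal_gen G).
Proof.
split; last by move=> a x b Sx I [cI GI]; apply: cI.2; apply: Sx.
split=> [|x y]; rewrite !inE.
  by move=> I [[[I0 _] _] _]; move: I0; rewrite inE.
move=> Sx Sy I [cI GI]; have [[_ IB] _] := cI.
by have := IB x y; rewrite !inE; apply; [apply: Sx | apply: Sy].
Qed.

End Commutators.

Section FreeAlgebra.
Variable K : fieldType.

(* The free unital associative algebra on x_0, x_1, ... is the algebra of the
   free monoid on nat: indices start at 0, so x, y, z are x_0, x_1, x_2. *)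
Definition freeF := {malg K[{fmonom nat}]}.
HB.instance Definition _ := GRing.Lalgebra.on freeF.

Definition fvar (i : nat) : freeF := << fmu i >>.

Definition X3 : set freeF := [set fvar 0; fvar 1; fvar 2].

Definition F3 : set freeF :=
  smallest [set S | GRing.subalg_closed [in S]] X3.

Definition lie_closed (S : set freeF) : Prop :=
  GRing.submod_closed [in S] /\ forall a b, S a -> S b -> S (commr a b).

Definition L3 : set freeF := smallest lie_closed X3.

Definition degF (f : freeF) : nat := \max_(w <- msupp f) size w.

Definition homogF (f : freeF) : Prop :=
  forall w, w \in msupp f -> size w = degF f.

(* T^(n) *)
Definition Tn (n : nat) : set freeF :=
  ideal_gen [set g | exists2 s : seq freeF, size s = n & g = lcommr s].

(* F^(n) = F / T^(n). Only unital ring and K-module structures are declared,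
   because F^(n) is the zero ring for n = 1. *)
Section RelativelyFree.
Variable n : nat.

Definition TnP : {pred freeF} := [in Tn n].

Lemma TnP_zmod_closed : GRing.zmod_closed TnP.
Proof. exact: (ideal_gen_closed _).1. Qed.

HB.instance Definition _ := GRing.isZmodClosed.Build freeF TnP TnP_zmod_closed.

Definition Fn := Quotient.quot TnP.
HB.instance Definition _ := Choice.on Fn.
HB.instance Definition _ := GRing.Zmodule.on Fn.

Local Notation pi := (\pi_Fn : freeF -> Fn).

Lemma Fn_piE (f g : freeF) : (pi f == pi g) = (f - g \in TnP).
Proof. by rewrite Quotient.idealrBE. Qed.

Lemma Fn_piB : {morph pi : f g / f - g}.
Proof. by move=> f g; rewrite !piE. Qed.

Lemma Fn_piD : {morph pi : f g / f + g}.
Proof. by move=> f g; rewrite !piE. Qed.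

Definition Fn_one : Fn := pi 1.
Definition Fn_mul (u v : Fn) : Fn := pi (repr u * repr v).
Definition Fn_scale (c : K) (u : Fn) : Fn := pi (c *: repr u).

Lemma TnP_mul (a x b : freeF) : x \in TnP -> a * x * b \in TnP.
Proof. by rewrite !inE; apply: (ideal_gen_closed _).2. Qed.

Lemma repr_piP (f : freeF) : repr (pi f) - f \in TnP.
Proof. by rewrite -Fn_piE reprK. Qed.

Lemma Fn_piM : {morph pi : f g / f * g >-> Fn_mul f g}.
Proof.
move=> f g; apply/eqP; rewrite /Fn_mul eq_sym Fn_piE.
have -> : repr (pi f) * repr (pi g) - f * g =
    1 * (repr (pi f) - f) * repr (pi g) + f * (repr (pi g) - g) * 1.
  by rewrite mul1r mulr1 mulrBl mulrBr addrA subrK.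
by rewrite rpredD ?TnP_mul ?repr_piP.
Qed.

Lemma Fn_piZ c : {morph pi : f / c *: f >-> Fn_scale c f}.
Proof.
move=> f; apply/eqP; rewrite /Fn_scale eq_sym Fn_piE.
have -> : c *: repr (pi f) - c *: f = c%:A * (repr (pi f) - f) * 1.
  by rewrite mulr1 -scalerAl mul1r scalerBr.
by rewrite TnP_mul ?repr_piP.
Qed.

Lemma Fn_surj (u : Fn) : exists f, u = pi f.
Proof. by exists (repr u); rewrite reprK. Qed.

Lemma Fn_mulA : associative Fn_mul.
Proof.
move=> u v w; have [f ->] := Fn_surj u; have [g ->] := Fn_surj v.
by have [h ->] := Fn_surj w; rewrite -!Fn_piM mulrA.
Qed.

Lemma Fn_mul1 : left_id Fn_one Fn_mul.
Proof. by move=> u; have [f ->] := Fn_surj u; rewrite -Fn_piM mul1r. Qed.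

Lemma Fn_mulr1 : right_id Fn_one Fn_mul.
Proof. by move=> u; have [f ->] := Fn_surj u; rewrite -Fn_piM mulr1. Qed.

Lemma Fn_mulDl : left_distributive Fn_mul +%R.
Proof.
move=> u v w; have [f ->] := Fn_surj u; have [g ->] := Fn_surj v.
by have [h ->] := Fn_surj w; rewrite -Fn_piD -!Fn_piM -Fn_piD mulrDl.
Qed.

Lemma Fn_mulDr : right_distributive Fn_mul +%R.
Proof.
move=> u v w; have [f ->] := Fn_surj u; have [g ->] := Fn_surj v.
by have [h ->] := Fn_surj w; rewrite -Fn_piD -!Fn_piM -Fn_piD mulrDr.
Qed.

HB.instance Definition _ :=
  GRing.Zmodule_isPzRing.Build Fn Fn_mulA Fn_mul1 Fn_mulr1 Fn_mulDl Fn_mulDr.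

Lemma Fn_scaleA a b (u : Fn) : Fn_scale a (Fn_scale b u) = Fn_scale (a * b) u.
Proof. by have [f ->] := Fn_surj u; rewrite -!Fn_piZ scalerA. Qed.

Lemma Fn_scale1 : left_id 1 Fn_scale.
Proof. by move=> u; have [f ->] := Fn_surj u; rewrite -Fn_piZ scale1r. Qed.

Lemma Fn_scaleDr : right_distributive Fn_scale +%R.
Proof.
move=> c u v; have [f ->] := Fn_surj u; have [g ->] := Fn_surj v.
by rewrite -Fn_piD -!Fn_piZ -Fn_piD scalerDr.
Qed.

Lemma Fn_scaleDl (u : Fn) : {morph Fn_scale^~ u : a b / a + b}.
Proof.
by move=> a b; have [f ->] := Fn_surj u; rewrite -!Fn_piZ -Fn_piD scalerDl.
Qed.

HB.instance Definition _ := GRing.Zmodule_isLmodule.Build K Fn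
  Fn_scaleA Fn_scale1 Fn_scaleDr Fn_scaleDl.

(* The value f(a_0, a_1, ...) in F^(n). *)
Definition evalFn (a : nat -> Fn) (f : freeF) : Fn :=
  \sum_(w <- msupp f) f@_w *: \prod_(i <- w) a i.

(* The identity f(x, y, z) = 0 in F^(n); meaningful for f in F3 *)
Definition identityFn (f : freeF) : Prop :=
  forall a b c : Fn, evalFn (nth 0 [:: a; b; c]) f = 0.

End RelativelyFree.

Section Weight.

Definition lincomb (J : choiceType) (v : J -> freeF) (c : {malg K[J]}) : freeF :=
  \sum_(j <- msupp c) c@_j *: v j.

Variables (d : Order.disp_t) (I : orderType d) (e : I -> freeF).

(* A totally ordered homogeneous basis of L3, indexed by I, in which elements of
   larger degree come first. *)
Record is_lie_basis : Prop := IsLieBasis {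
  lie_basis_free : injective (lincomb e);
  lie_basis_span : range (lincomb e) = L3;
  lie_basis_homog : forall i, homogF (e i);
  lie_basis_order : forall i j, (degF (e j) < degF (e i))%N -> (i < j)%O
}.

(* The regular words e_{i_1} ... e_{i_t} are encoded by their index sequences,
   nondecreasing for the order of I. *)
Definition regular (v : seq I) : bool := sorted <=%O v.

Definition word_val (v : seq I) : freeF := \prod_(i <- v) e i.

Definition word_wt (v : seq I) : int :=
  \sum_(i <- v) (degF (e i))%:Z - (size v)%:Z + 1.

Definition regular_expansion (f : freeF) (c : {malg K[seq I]}) : Prop :=
  (forall v, v \in msupp c -> regular v) /\ lincomb word_val c = f.

(* By the Poincare-Birkhoff-Witt theorem every f in F3 has exactly one regular
   expansion, which is then the one selected here. *)
Definition regular_coeffs (f : freeF) : {malg K[seq I]} :=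
  xget 0 (regular_expansion f).

(* The empty minimum gives wt 0 = +oo. *)
Definition wt (f : freeF) : \bar int :=
  \big[Order.min/+oo%E]_(v <- msupp (regular_coeffs f)) (word_wt v)%:E.

End Weight.
End FreeAlgebra.

(* Main.v *)
Require Import Defs.
From HB Require Import structures.
From mathcomp Require Import all_boot all_order all_algebra ring_quotient.
From mathcomp Require Import finmap zify.
From mathcomp.multinomials Require Import monalg.
From mathcomp Require Import boolp classical_sets cardinality constructive_ereal.

(** The weight filtration turns products and commutators of Lie elements into
    the inequalities wt(fg) >= wt f + wt g - 1 and wt[f,g] >= wt f + wt g, so
    T^(n) meets F_3 in elements of weight at least n.  That the weight read off
    from a regular expansion is the right one needs uniqueness of this expansion
    (PBW): F_3 being free, the action of L_3 on the space of regular words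
    extends to F_3, and f, applied to the empty word, returns its own regular
    expansion.

    Conversely it suffices that a product of Lie elements of degrees d_1, ..., d_k
    in x, y, z lies in T^(d_1 + ... + d_k - k + 1).  An identity of Feigin and
    Shoikhet gives T^(p)T^(q) <= T^(p+q-1) when p or q is odd, for any number of
    variables.  For a, b of even degree, expanding [uv,s,s] (u, v odd) and
    [ab,s,t] shows that modulo T^(p+q-1) the product [u,s][v,t] alternates in
    s, t, and that two letters can be moved from one factor to the other.  Hence ab
    reduces to [u',t,a,x][y,z], which alternates in the four letters t, x, y, z
    and so vanishes because only three letters are available. *)

Set Implicit Arguments.
Unset Strict Implicit.
Unset Printing Implicit Defensive.

Import Order.TTheory GRing.Theory Num.Theory.
Local Open Scope classical_set_scope.
Local Open Scope quotient_scope.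
Local Open Scope ring_scope.

(** * Linear spans and noncommutative identities *)

Section Span.
Variables (K : fieldType) (V : lmodType K).

Definition lin_closed (P : V -> Prop) : Prop :=
  P 0 /\ forall c f g, P f -> P g -> P (c *: f + g).

Inductive span (G : V -> Prop) : V -> Prop :=
| span_0 : span G 0
| span_S c g f : G g -> span G f -> span G (c *: g + f).

Section Closed.
Variables (P : V -> Prop) (cP : lin_closed P).

Lemma closed0 : P 0. Proof. exact: cP.1. Qed.

Lemma closedZ c f : P f -> P (c *: f).
Proof. by move=> Pf; rewrite -[_ *: f]addr0; apply: cP.2 => //; apply: cP.1. Qed.

Lemma closedD f g : P f -> P g -> P (f + g).
Proof. by move=> Pf Pg; rewrite -[f]scale1r; apply: cP.2. Qed.

Lemma closedN f : P f -> P (- f).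
Proof. by rewrite -scaleN1r; apply: closedZ. Qed.

Lemma closedB f g : P f -> P g -> P (f - g).
Proof. by move=> Pf Pg; apply: closedD => //; apply: closedN. Qed.

Lemma closed_sum (J : eqType) (r : seq J) (F : J -> V) :
  (forall j, j \in r -> P (F j)) -> P (\sum_(j <- r) F j).
Proof.
move=> PF; rewrite big_seq; elim/big_ind: _ => //; first exact: closed0.
exact: closedD.
Qed.

Lemma closed_divn n f : n%:R != 0 :> K -> P (f *+ n) -> P f.
Proof.
by move=> n0 /(closedZ n%:R^-1); rewrite -scaler_nat scalerA mulVf // scale1r.
Qed.

Lemma span_min (G : V -> Prop) : (forall g, G g -> P g) -> forall f, span G f -> P f.
Proof.
move=> GP f; elim=> [|c g {}f Gg _ Pf]; first exact: closed0.
by apply: cP.2 => //; apply: GP.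
Qed.

End Closed.

Lemma span_gen (G : V -> Prop) g : G g -> span G g.
Proof.
by move=> Gg; rewrite -[g]scale1r -[_ *: g]addr0; apply: span_S Gg (span_0 G).
Qed.

Lemma span_closed (G : V -> Prop) : lin_closed (span G).
Proof.
split=> [|c f g sf sg]; first exact: span_0.
elim: sf => [|d h {}f Gh _ IH]; first by rewrite scaler0 add0r.
by rewrite scalerDr scalerA -addrA; apply: span_S.
Qed.

Lemma span_mono (G H : V -> Prop) :
  (forall g, G g -> H g) -> forall f, span G f -> span H f.
Proof.
by move=> GH; apply: (span_min (span_closed H)) => g /GH; apply: span_gen.
Qed.

End Span.

(** This settles the closure condition each time a property of an expression linear in one argument
    is checked on a spanning set only. *)
Lemma closed_preim (K : fieldType) (V W : lmodType K) (h : V -> W) (P : W -> Prop) :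
  (forall c f g, h (c *: f + g) = c *: h f + h g) ->
  lin_closed P -> lin_closed (fun f => P (h f)).
Proof.
move=> hl cP; split=> [|c f g Pf Pg]; last by rewrite hl; apply: cP.2.
by have := hl (-1) 0 0; rewrite scaler0 add0r scaleN1r addNr => ->; apply: cP.1.
Qed.

(** * Normalisation by reflection of identities in noncommuting variables *)

Section NoncommutativeNormalization.

Inductive nexp :=
  NVar of nat | NAdd of nexp & nexp | NOpp of nexp | NMul of nexp & nexp | NZero.

(** Polynomials become lists of signed monomials, [true] standing for the sign -1. Multiplicities
    are repeated entries, since [ncring] first unfolds integer multiples into sums. *)
Fixpoint nnorm (t : nexp) : seq (bool * seq nat) :=
  match t with
  | NVar i => [:: (false, [:: i])]
  | NAdd t u => nnorm t ++ nnorm u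
  | NOpp t => [seq (~~ m.1, m.2) | m <- nnorm t]
  | NMul t u => [seq (m.1 (+) m'.1, m.2 ++ m'.2) | m <- nnorm t, m' <- nnorm u]
  | NZero => [::]
  end.

Fixpoint ncancel (m : bool * seq nat) (s : seq (bool * seq nat)) :=
  if s is m' :: s' then
    if (m.1 != m'.1) && (m.2 == m'.2) then s' else m' :: ncancel m s'
  else [:: m].

Definition nzero (t : nexp) := nilp (foldr ncancel [::] (nnorm t)).

Variables (R : pzRingType) (env : seq R).

Fixpoint neval (t : nexp) : R :=
  match t with
  | NVar i => nth 0 env i
  | NAdd t u => neval t + neval u
  | NOpp t => - neval t
  | NMul t u => neval t * neval u
  | NZero => 0
  end.

Let meval (m : bool * seq nat) : R := (-1) ^+ m.1 * \prod_(i <- m.2) nth 0 env i.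

Lemma nnormE t : neval t = \sum_(m <- nnorm t) meval m.
Proof.
elim: t => [i|t IHt u IHu|t IHt|t IHt u IHu|] /=.
- by rewrite big_seq1 /meval /= big_seq1 mul1r.
- by rewrite big_cat IHt IHu.
- rewrite big_map IHt -sumrN; apply: eq_bigr => m _.
  by rewrite /meval /= signrN mulNr.
- rewrite big_allpairs_dep IHt IHu mulr_suml; apply: eq_bigr => m _.
  rewrite mulr_sumr; apply: eq_bigr => m' _.
  rewrite /meval /= big_cat signr_addb /= -!mulrA; congr (_ * _).
  by rewrite !mulrA (commr_sign _ m'.1).
- by rewrite big_nil.
Qed.

Lemma ncancelE m s : \sum_(p <- ncancel m s) meval p = meval m + \sum_(p <- s) meval p.
Proof.
elim: s => [|m' s IH] /=; first by rewrite big_seq1 big_nil addr0.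
case: ifP => [/andP[sm /eqP mm]|_].
  rewrite big_cons addrA /meval mm -mulrDl.
  have -> : m'.1 = ~~ m.1 by case: m.1 m'.1 sm => [] [].
  by rewrite signrN addrN mul0r add0r.
by rewrite !big_cons IH addrCA.
Qed.

Lemma nzeroP t : nzero t -> neval t = 0.
Proof.
rewrite nnormE => /nilP; elim: (nnorm t) => [|m s IH] /= h; first by rewrite big_nil.
have {IH}E : \sum_(p <- foldr ncancel [::] s) meval p = \sum_(p <- s) meval p.
  elim: {h IH} s => [|p s IH] /=; first by [].
  by rewrite ncancelE IH big_cons.
by rewrite big_cons -E -ncancelE h big_nil.
Qed.

End NoncommutativeNormalization.

Ltac nc_index env x :=
  match env with
  | cons x _ => constr:(0%N)
  | cons _ ?e => let n := nc_index e x in constr:(S n)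
  end.
Ltac nc_reify env t :=
  match t with
  | (?a + ?b)%R => let u := nc_reify env a in let v := nc_reify env b in constr:(NAdd u v)
  | (- ?a)%R => let u := nc_reify env a in constr:(NOpp u)
  | (?a * ?b)%R => let u := nc_reify env a in let v := nc_reify env b in constr:(NMul u v)
  | 0%R => constr:(NZero)
  | _ => let n := nc_index env t in constr:(NVar n)
  end.
Ltac ncring env :=
  rewrite ?mulr2n ?mulrS ?mulr0n ?addr0 /commr; apply/eqP; rewrite -subr_eq0; apply/eqP;
  match goal with |- ?l = 0 =>
    let t := nc_reify env l in
    change (neval env t = 0); apply: nzeroP; vm_compute; exact: isT
  end.

Section Commutator.
Variable R : pzRingType.
Implicit Types a b c d : R.

Lemma commrC a b : commr a b = - commr b a.
Proof. ncring [:: a; b]. Qed.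

Lemma commr_jacobi a b c :
  commr a (commr b c) = commr (commr a b) c - commr (commr a c) b.
Proof. ncring [:: a; b; c]. Qed.

Lemma commr_derivation a b c :
  commr a (commr b c) - commr b (commr a c) = commr (commr a b) c.
Proof. ncring [:: a; b; c]. Qed.

Lemma commrMl a b c : commr (a * b) c = a * commr b c + commr a c * b.
Proof. ncring [:: a; b; c]. Qed.

Lemma commrMr a b c : commr a (b * c) = commr a b * c + b * commr a c.
Proof. ncring [:: a; b; c]. Qed.

Lemma commrDl a b c : commr (a + b) c = commr a c + commr b c.
Proof. ncring [:: a; b; c]. Qed.

Lemma commrDr a b c : commr a (b + c) = commr a b + commr a c.
Proof. ncring [:: a; b; c]. Qed.

(** The Leibniz rule applied twice. [idc_polar] solves it for the mixed terms in parentheses,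
    [idc_shift] for the two outer ones. *)
Lemma commr2M a b x y : commr (commr (a * b) x) y =
  commr (commr a x) y * b + a * commr (commr b x) y
  + (commr a x * commr b y + commr a y * commr b x).
Proof. ncring [:: a; b; x; y]. Qed.

(* The right-hand side was found by linear algebra. What matters is that u lies in
   the innermost entry of every commutator. *)
Lemma feigin_shoikhet u a b e x : commr (x * commr (commr u a) b) e *+ 3 =
  commr (commr (commr (u * x) e) b) a *+ 2
  + commr (commr (commr u a) e) (x * b)
  - commr (commr (commr (u * a) e) x) b
  - commr (commr (commr (u * x) a) e) b
  - commr (commr (commr u x) a) (e * b)
  + commr (commr (commr (u * b) x) a) e
  + commr (commr (commr (x * u) a) b) e
  - commr (commr (commr (e * u) x) a) b
  + commr (commr (commr (u * e) b) a) x
  - commr (commr (commr u e) b) (a * x)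
  + commr (commr (commr (b * u) x) e) a *+ 2
  + commr (commr (commr (e * u) b) x) a *+ 2
  - commr (commr (commr u a) (b * e)) x *+ 2
  + commr (commr (commr u e) x) (b * a)
  - commr (commr (commr u e) (x * b)) a
  - commr (commr (commr u x) e) (b * a) *+ 2
  + commr (commr (commr u x) (a * e)) b *+ 2
  - commr (commr (commr u b) x) (a * e) *+ 2
  - commr (commr (commr u b) a) (e * x)
  + commr (commr (commr (u * b) a) e) x
  + commr (commr (commr u a) b) (e * x) *+ 2
  + commr (commr (commr (a * u) e) b) x
  + commr (commr (commr u b) (x * a)) e
  + commr (commr (commr (a * u) b) x) e.
Proof. ncring [:: u; a; b; e; x]. Qed.

End Commutator.

(** * Products of lower central ideals *)

Section LowerCentral.
Variables (K : fieldType) (R : lalgType K).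
Hypothesis scalerAr : forall (c : K) (a b : R), c *: (a * b) = a * (c *: b).
Implicit Types (a b l m u v : R) (c : K).

Lemma commr_linl a c u v : commr (c *: u + v) a = c *: commr u a + commr v a.
Proof. by rewrite commrDl /commr -scalerAl -scalerAr -scalerBr. Qed.

Lemma commr_linr a c u v : commr a (c *: u + v) = c *: commr a u + commr a v.
Proof. by rewrite commrDr /commr -scalerAl -scalerAr -scalerBr. Qed.

Lemma mul_linl a c u v : (c *: u + v) * a = c *: (u * a) + v * a.
Proof. by rewrite mulrDl scalerAl. Qed.

Lemma mul_linr a c u v : a * (c *: u + v) = c *: (a * u) + a * v.
Proof. by rewrite mulrDr scalerAr. Qed.

(* lcomm G k is spanned by the left-normed commutators of length k + 1 with
   entries in G; thus T^(n) is idc n.-1 below. *)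
Fixpoint lcomm (G : R -> Prop) (k : nat) : R -> Prop :=
  match k with
  | 0 => span G
  | k.+1 => span (fun g => exists l a, [/\ lcomm G k l, G a & g = commr l a])
  end.

Lemma lcomm_closed G k : lin_closed (lcomm G k).
Proof. by case: k => [|k]; apply: span_closed. Qed.

Lemma lcommS G k l a : lcomm G k l -> span G a -> lcomm G k.+1 (commr l a).
Proof.
move=> Ll; have cP := closed_preim (commr_linr l) (lcomm_closed G k.+1).
by apply: (span_min cP) => b Gb; apply: span_gen; exists l, b.
Qed.

Lemma lcommS_ind G k (P : R -> Prop) : lin_closed P ->
  (forall l a, lcomm G k l -> G a -> P (commr l a)) ->
  forall l, lcomm G k.+1 l -> P l.
Proof. by move=> cP h; apply: (span_min cP) => g [l [a [Ll Ga ->]]]; apply: h. Qed.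

Lemma lcomm0_ind G (P : R -> Prop) : lin_closed P ->
  (forall a, G a -> P a) -> forall l, lcomm G 0 l -> P l.
Proof. by move=> cP h; apply: (span_min cP). Qed.

(** By the Jacobi identity, bracketing with [[m,a]] is a difference of successive bracketings with
    [m] and [a], so the length of the second entry can be reduced. Indices are lengths minus one,
    whence the extra successor. *)
Lemma lcomm_commr G j k l m :
  lcomm G j l -> lcomm G k m -> lcomm G (j + k).+1 (commr l m).
Proof.
elim: k j l m => [|k IH] j l m Ll; first by rewrite addn0; apply: lcommS.
move: m; apply: lcommS_ind => [|m a Lm Ga].
  exact: (closed_preim (commr_linr l)) (lcomm_closed _ _).
rewrite commr_jacobi addnS; apply: (closedB (lcomm_closed _ _)).
  by apply: lcommS (span_gen Ga); apply: IH.
by rewrite -addSn; apply: IH Lm; apply: lcommS Ll (span_gen Ga).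
Qed.

Local Notation LC := (lcomm (fun _ => True)).

Lemma LC0 a : LC 0 a. Proof. exact: span_gen. Qed.

Lemma lcomm_LC G k l : lcomm G k l -> LC k l.
Proof.
elim: k l => [|k IH] l; first by move=> _; apply: LC0.
move: l; apply: lcommS_ind; first exact: lcomm_closed.
by move=> l a /IH Ll _; apply: lcommS (LC0 a).
Qed.

Lemma LC_S k l a : LC k l -> LC k.+1 (commr l a).
Proof. by move=> Ll; apply: lcommS (LC0 a). Qed.

(** Entries are arbitrary ring elements, so the innermost commutator may be read as a single
    entry. *)
Lemma LC_pred k l : LC k.+1 l -> LC k l.
Proof.
elim: k l => [|k IH] l; first by move=> _; apply: LC0.
move: l; apply: lcommS_ind; first exact: lcomm_closed.
by move=> l a /IH Ll _; apply: LC_S.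
Qed.

(** Only left multiples are taken; the ideal is two-sided because a right factor [a] passes [l] at
    the cost of [[l,a]], a longer commutator ([idc_mulr]). *)
Definition idc k : R -> Prop := span (fun g => exists a l, LC k l /\ g = a * l).

Lemma idc_closed k : lin_closed (idc k).
Proof. exact: span_closed. Qed.

Lemma idc_ind k (P : R -> Prop) : lin_closed P ->
  (forall a l, LC k l -> P (a * l)) -> forall m, idc k m -> P m.
Proof. by move=> cP h; apply: (span_min cP) => g [a [l [Ll ->]]]; apply: h. Qed.

Lemma idc_mull k a m : idc k m -> idc k (a * m).
Proof.
move: m; apply: idc_ind; first exact: (closed_preim (mul_linr a)) (idc_closed k).
by move=> b l Ll; rewrite mulrA; apply: span_gen; exists (a * b), l.
Qed.

Lemma LC_idc k l : LC k l -> idc k l.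
Proof. by move=> Ll; apply: span_gen; exists 1, l; rewrite mul1r. Qed.

Lemma idc_mulr k m a : idc k m -> idc k (m * a).
Proof.
move: m; apply: idc_ind; first exact: (closed_preim (mul_linl a)) (idc_closed k).
move=> b l Ll; rewrite -mulrA; apply: idc_mull.
have -> : l * a = a * l + commr l a by rewrite /commr addrC subrK.
apply: (closedD (idc_closed k)); first by apply: idc_mull; apply: LC_idc.
by apply: LC_idc; apply: LC_pred; apply: LC_S.
Qed.

Lemma idc_pred k m : idc k.+1 m -> idc k m.
Proof.
move: m; apply: idc_ind; first exact: idc_closed.
by move=> a l /LC_pred Ll; apply: idc_mull; apply: LC_idc.
Qed.

Lemma idc0 a : idc 0 a.
Proof. exact: LC_idc (LC0 a). Qed.

(** * Products of T-ideals with one factor of odd length, that is of even index *)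

Section OddLength.

(* A product of two letters in which one factor u ranges over LC j lies in idc j,
   so its commutators behave as those of u itself: every summand of the
   Feigin-Shoikhet identity then lies in LC (j + 3). *)
Definition idc_commr_LC j := forall m a, idc j m -> LC j.+1 (commr m a).

Lemma idc_commr_LC_SS j : 3%:R != 0 :> K -> idc_commr_LC j -> idc_commr_LC j.+2.
Proof.
move=> K3 Hj m e; move: m.
apply: idc_ind; first exact: (closed_preim (commr_linl e)) (lcomm_closed _ _).
move=> x w; move: w; apply: lcommS_ind.
  apply: (closed_preim (h := fun w => commr (x * w) e)) (lcomm_closed _ _).
  by move=> c f g; rewrite mul_linr commr_linl.
move=> w b; move=> Lw _; move: w Lw; apply: lcommS_ind.
  apply: (closed_preim (h := fun w => commr (x * commr w b) e)) (lcomm_closed _ _).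
  by move=> c f g; rewrite commr_linl mul_linr commr_linl.
move=> u a Lu _; apply: (closed_divn (lcomm_closed _ _) K3).
have ul y : idc j (u * y) by apply: idc_mulr; apply: LC_idc.
have ur y : idc j (y * u) by apply: idc_mull; apply: LC_idc.
(* The hypothesis on [j] absorbs the first bracket of an element of [idc j], and two more brackets
   reach index [j + 3]. Every summand of the identity has this shape, with [u] or a product of [u]
   and a letter innermost. *)
have Lc : forall m p q r, idc j m -> LC j.+3 (commr (commr (commr m p) q) r).
  by move=> m p q r Im; do 2!apply: LC_S; apply: Hj.
have cL := lcomm_closed (fun _ => True) j.+3.
have Lu1 := LC_idc Lu.
rewrite feigin_shoikhet !mulr2n.
repeat match goal with
| |- lcomm _ _ (_ + _) => apply: (closedD cL)
| |- lcomm _ _ (- _) => apply: (closedN cL)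
| |- lcomm _ _ (commr _ _) => apply: Lc; by []
end.
Qed.

(** At [j = 0] every element qualifies, and the Feigin-Shoikhet step raises [j] by two: this is
    where parity enters. *)
Lemma idc_commr_even j : 3%:R != 0 :> K -> ~~ odd j -> idc_commr_LC j.
Proof.
move=> K3 oj; rewrite -(even_halfK oj) -muln2 mulnC.
elim: (j./2) => [|i IH]; first by rewrite muln0 => m a _; apply: LC_S (LC0 m).
by rewrite mulnS; apply: idc_commr_LC_SS.
Qed.

Lemma idc_commr_evenLC j k m l : 3%:R != 0 :> K -> ~~ odd j ->
  idc j m -> LC k l -> LC (j + k).+1 (commr m l).
Proof.
move=> K3 oj Im; elim: k l => [|k IH] l.
  by move=> _; rewrite addn0; apply: idc_commr_even.
move: l; apply: lcommS_ind => [|l a Ll _].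
  exact: (closed_preim (commr_linr m)) (lcomm_closed _ _).
rewrite commr_jacobi addnS; apply: (closedB (lcomm_closed _ _)).
  by apply: LC_S; apply: IH.
by rewrite -addSn; apply: lcomm_commr => //; apply: idc_commr_even.
Qed.

(** A factor [[l,a]] is removed by [m[l,a] = [m,l]a - [ma,l]]: both [m] and [ma] lie in the ideal of
    even index, so their brackets with [l] are combinations of long commutators. *)
Lemma idc_mul_evenl j k m n : 3%:R != 0 :> K -> ~~ odd j ->
  idc j m -> idc k n -> idc (j + k) (m * n).
Proof.
move=> K3 oj Im; move: n; apply: idc_ind.
  exact: (closed_preim (mul_linr m)) (idc_closed _).
move=> x l Ll; rewrite mulrA; move: (m * x) (idc_mulr x Im) => {x Im}{}m Im.
case: k l Ll => [|k] l; first by move=> _; rewrite addn0; apply: idc_mulr.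
move: l; apply: lcommS_ind.
  exact: (closed_preim (mul_linr m)) (idc_closed _).
move=> l a Ll _.
have -> : m * commr l a = commr m l * a - commr (m * a) l.
  by rewrite commrMl (commrC a) mulrN opprD opprK addrCA subrr addr0.
rewrite addnS; apply: (closedB (idc_closed _)); last first.
  by apply: LC_idc; apply: idc_commr_evenLC => //; apply: idc_mulr.
by apply: idc_mulr; apply: LC_idc; apply: idc_commr_evenLC.
Qed.

Lemma idc_mul_evenr j k m n : 3%:R != 0 :> K -> ~~ odd k ->
  idc j m -> idc k n -> idc (j + k) (m * n).
Proof.
move=> K3 ok Im In; move: m Im; apply: idc_ind.
  exact: (closed_preim (mul_linl n)) (idc_closed _).
move=> a l Ll; rewrite -mulrA; apply: idc_mull.
have -> : l * n = n * l - commr n l by rewrite /commr opprB addrC subrK.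
rewrite addnC; apply: (closedB (idc_closed _)).
  by apply: idc_mul_evenl (LC_idc Ll).
by apply: LC_idc; apply: LC_pred; apply: idc_commr_evenLC.
Qed.

End OddLength.

(** * Products of commutators in three letters *)

Section ThreeLetters.
Hypotheses (K2 : 2%:R != 0 :> K) (K3 : 3%:R != 0 :> K).
Variable X : 'I_3 -> R.

Local Notation Lh := (lcomm (fun a => exists i, a = X i)).

(** These are the mixed terms of [[[uv,x],y]]. That commutator is long because [uv] lies in an ideal
    of even index, and in each outer term one factor keeps an even index, so the product theorem
    applies. *)
Lemma idc_polar r s u v x y : ~~ odd r -> ~~ odd s -> LC r u -> LC s v ->
  idc (r + s).+2 (commr u x * commr v y + commr u y * commr v x).
Proof.
move=> er es Lu Lv; have cI := idc_closed (r + s).+2.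
have -> : commr u x * commr v y + commr u y * commr v x =
    commr (commr (u * v) x) y - commr (commr u x) y * v - u * commr (commr v x) y.
  by rewrite commr2M -addrA -opprD addrAC addrN add0r.
apply: (closedB cI); first apply: (closedB cI).
- apply: LC_idc; apply: LC_S; apply: idc_commr_even => //; first by rewrite oddD; lia.
  exact: idc_mul_evenl (LC_idc Lu) (LC_idc Lv).
- have -> : (r + s).+2 = (r.+2 + s)%N by lia.
  by apply: idc_mul_evenr (LC_idc Lv) => //; apply: LC_idc; do 2!apply: LC_S.
- have -> : (r + s).+2 = (r + s.+2)%N by lia.
  by apply: idc_mul_evenl (LC_idc Lu) _ => //; apply: LC_idc; do 2!apply: LC_S.
Qed.

Lemma idc_alt r s u v x : ~~ odd r -> ~~ odd s -> LC r u -> LC s v ->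
  idc (r + s).+2 (commr u x * commr v x).
Proof.
move=> er es Lu Lv; apply: (closed_divn (idc_closed _) K2).
by rewrite mulr2n; apply: idc_polar.
Qed.

(** Two letters pass from one factor to the other up to sign. Here the mixed terms [[a,p][b,q]] are
    harmless, as their factors have even index, and the last hypothesis controls [[[ab,p],q]]. *)
Lemma idc_shift j k a b p q : odd j -> odd k -> LC j a -> LC k b ->
  idc (j + k) (a * b) ->
  idc (j + k).+2 (commr (commr a p) q * b + a * commr (commr b p) q).
Proof.
move=> oj ok La Lb Iab; have cI := idc_closed (j + k).+2.
have -> : commr (commr a p) q * b + a * commr (commr b p) q =
    commr (commr (a * b) p) q - (commr a p * commr b q + commr a q * commr b p).
  by rewrite commr2M addrK.
apply: (closedB cI).
  by apply: LC_idc; apply: LC_S; apply: idc_commr_even => //; rewrite oddD; lia.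
have -> : (j + k).+2 = (j.+1 + k.+1)%N by lia.
by apply: (closedD (idc_closed _)); apply: idc_mul_evenl => //=;
  rewrite ?oj //; apply: LC_idc; apply: LC_S.
Qed.

Lemma pigeonhole3 (t x y z : 'I_3) :
  [\/ x = y, x = z, y = z | [\/ t = x, t = y | t = z]].
Proof.
case: (eqVneq x y) => [->|]; first by constructor 1.
case: (eqVneq x z) => [->|]; first by constructor 2.
case: (eqVneq y z) => [->|]; first by constructor 3.
rewrite -!val_eqE => yz xz xy; constructor 4.
case: (eqVneq t x) => [->|]; first by constructor 1.
case: (eqVneq t y) => [->|]; first by constructor 2.
rewrite -!val_eqE => ty tx; constructor 3; apply: val_inj; move: tx yz xz xy ty.
by move: t x y z => [[|[|[|t]]] lt] [[|[|[|x]]] lx] [[|[|[|y]]] ly] [[|[|[|z]]] lz].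
Qed.

(* Once D is alternating in x, y, z, it suffices that it vanishes for t = x: four
   letters out of three cannot be distinct. *)
Lemma alternating_on_three (P : R -> Prop) (D : 'I_3 -> 'I_3 -> 'I_3 -> R) t :
  lin_closed P ->
  (forall x y z, P (D x y z + D x z y)) -> (forall x z, P (D x z z)) ->
  (forall x y z, P (D x y z + D z y x)) -> (forall x y, P (D x y x)) ->
  (forall y z, P (D t y z)) -> forall x y z, P (D x y z).
Proof.
move=> cP s23 a23 s13 a13 Dt x y z.
have opp u v : P (u + v) -> P v -> P u.
  by move=> Puv Pv; rewrite -[u](addrK v); apply: closedB.
have a12 x' z' : P (D x' x' z').
  exact: opp _ _ (s23 x' x' z') (a13 x' z').
case: (pigeonhole3 t x y z) => [->|->|->|[<-|<-|<-]] //.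
- exact: opp _ _ (s23 x t z) (opp _ _ (s13 x z t) (Dt z x)).
- exact: opp _ _ (s13 x y t) (Dt y x).
Qed.

(** The product alternates in [x, y, z]: in [y, z] by antisymmetry of the bracket, in [x, z] by
    [idc_polar] with [v] a letter. A fourth letter [t] from the left factor then forces a
    coincidence, which leaves the case [x = t]. *)
Lemma idc_letters_odd r u x y z : ~~ odd r -> Lh r u ->
  idc r.+2 (commr u (X x) * commr (X y) (X z)).
Proof.
move=> er; rewrite -(even_halfK er) -muln2 mulnC.
elim: (r./2) u x y z => {er}[|i IH] u x y z.
  rewrite muln0; move: u; apply: lcomm0_ind.
    apply: (closed_preim (h := fun u => commr u (X x) * commr (X y) (X z))).
      by move=> c f g; rewrite commr_linl mul_linl.
    exact: idc_closed.
  move=> _ [t ->]; move: x y z.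
  apply: (@alternating_on_three _
    (fun x y z => commr (X t) (X x) * commr (X y) (X z)) t (idc_closed 2)).
  - move=> x y z; rewrite (commrC (X z)) mulrN addrN; exact: closed0 (idc_closed 2).
  - move=> x z; rewrite {2}/commr addrN mulr0; exact: closed0 (idc_closed 2).
  - by move=> x y z; apply: (@idc_polar 0 0) => //; apply: LC0.
  - by move=> x y; apply: (@idc_alt 0 0) => //; apply: LC0.
  - move=> y z; rewrite {1}/commr addrN mul0r; exact: closed0 (idc_closed 2).
rewrite mulnS; set s := (2 * i)%N in IH *; have es : ~~ odd s by rewrite oddM.
(* Two letters [t], [a] are peeled off the left factor; [t] serves as the fourth letter. *)
move: u x y z; suff h : forall u, Lh s u -> forall t a x y z : 'I_3,
    idc s.+4 (commr (commr (commr u (X t)) (X a)) (X x) * commr (X y) (X z)).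
  move=> u x y z; move: u; apply: lcommS_ind.
    apply: (closed_preim (h := fun u => commr u (X x) * commr (X y) (X z))).
      by move=> c f g; rewrite commr_linl mul_linl.
    exact: idc_closed.
  move=> u _ Lu [a ->]; move: u Lu; apply: lcommS_ind.
    apply: (closed_preim
      (h := fun u => commr (commr u (X a)) (X x) * commr (X y) (X z))).
      by move=> c f g; rewrite !commr_linl mul_linl.
    exact: idc_closed.
  by move=> u _ Lu [t ->]; apply: h.
move=> u Lu t a.
have Lu' := lcomm_LC Lu; have cI := idc_closed s.+4.
have L2 : LC s.+2 (commr (commr u (X t)) (X a)) by do 2!apply: LC_S.
apply: (@alternating_on_three _ (fun x y z =>
  commr (commr (commr u (X t)) (X a)) (X x) * commr (X y) (X z)) t cI).
- move=> x y z; rewrite (commrC (X z)) mulrN addrN; exact: closed0 cI.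
- move=> x z; rewrite {4}/commr addrN mulr0; exact: closed0 cI.
- move=> x y z; have := @idc_polar s.+2 0 _ (X y) (X x) (X z) _ isT L2 (LC0 _).
  by rewrite addn0; apply; rewrite /= es.
- move=> x y; have := @idc_alt s.+2 0 _ (X y) (X x) _ isT L2 (LC0 _).
  by rewrite addn0; apply; rewrite /= es.
(* For [x = t], [idc_shift] moves [a] and [t] to the right factor, its product hypothesis being the
   induction hypothesis. The result [[u,t][[[y,z],a],t]] repeats [t] and falls to [idc_alt]. *)
- move=> y z; rewrite -[_ * _](addrK (commr u (X t) *
    commr (commr (commr (X y) (X z)) (X a)) (X t))); apply: (closedB cI).
    have := @idc_shift s.+1 1 (commr u (X t)) (commr (X y) (X z)) (X a) (X t).
    rewrite addn1; apply => //=; first by apply: LC_S.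
      by apply: (@LC_S 0); apply: LC0.
    exact: IH.
  have := @idc_alt s 2 u (commr (commr (X y) (X z)) (X a)) (X t) es isT Lu'.
  rewrite addn2; apply; apply: LC_S; apply: (@LC_S 0); exact: LC0.
Qed.

(** Letters are moved in pairs from [b] to [a] until [b] is a commutator of two letters, the case of
    [idc_letters_odd]. Hence [j] stays general in the induction on [k]. *)
Lemma idc_letters_odd_odd j k a b : odd j -> odd k -> Lh j a -> Lh k b ->
  idc (j + k) (a * b).
Proof.
move=> oj ok; have -> : k = (2 * k./2).+1 by lia.
elim: (k./2) j oj a b => {ok}[|i IH] j oj a b La.
  move: b; apply: lcommS_ind; first exact: (closed_preim (mul_linr a)) (idc_closed _).
  move=> b _ Lb [z ->]; move: b Lb; apply: lcomm0_ind.
    apply: (closed_preim (h := fun b => a * commr b (X z))) (idc_closed _).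
    by move=> c f g; rewrite commr_linl mul_linr.
  move=> _ [y ->]; case: j oj a La => // j ej; apply: lcommS_ind.
    apply: (closed_preim (h := fun a => a * _)) (idc_closed _).
    by move=> c f g; rewrite mul_linl.
  by move=> u _ Lu [x ->]; rewrite addn1; apply: idc_letters_odd.
move: b; rewrite mulnS; set s := (2 * i)%N in IH *; have es : ~~ odd s by rewrite oddM.
apply: lcommS_ind; first exact: (closed_preim (mul_linr a)) (idc_closed _).
move=> b _ Lb [q ->]; move: b Lb; apply: lcommS_ind.
  apply: (closed_preim (h := fun b => a * commr b (X q))) (idc_closed _).
  by move=> c f g; rewrite commr_linl mul_linr.
move=> b _ Lb [p ->].
rewrite -[a * _](addKr (commr (commr a (X p)) (X q) * b)) addrC.
have -> : (j + (2 + s).+1 = (j + s.+1).+2)%N by lia.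
apply: (closedB (idc_closed _)).
  by apply: idc_shift => //; [apply: lcomm_LC La|apply: lcomm_LC Lb|apply: IH].
have -> : (j + s.+1).+2 = (j.+2 + s.+1)%N by lia.
apply: IH => //; first by rewrite /= negbK.
by do 2!(apply: lcommS; last by apply: span_gen; eexists).
Qed.

(** The first index counts the Lie factors; the second adds up their degrees minus one each, which
    is the weight of the product less one. *)
Inductive lie_prod : nat -> nat -> R -> Prop :=
| lie_prod_nil : lie_prod 0 0 1
| lie_prod_cons d l n w f :
    Lh d l -> lie_prod n w f -> lie_prod n.+1 (d + w) (l * f).

Lemma lie_prod_cat n w f n' w' f' :
  lie_prod n w f -> lie_prod n' w' f' -> lie_prod (n + n') (w + w') (f * f').
Proof.
move=> Pf Pf'; elim: Pf => [|d l {}n {}w {}f Ll _ IH]; first by rewrite mul1r.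
by rewrite -mulrA -addnA addSn; apply: lie_prod_cons.
Qed.

(** By the Leibniz rule [l] is absorbed into one factor at a time, so the number of factors stays
    fixed while the weight grows by one. *)
Lemma lie_prod_commr n w f d l : lie_prod n w f -> Lh d l ->
  span (lie_prod n (w + d).+1) (commr f l).
Proof.
move=> Pf Ll; elim: Pf => [|d' l' {}n {}w {}f Ll' Pf IH].
  by rewrite /commr mul1r mulr1 subrr; apply: span_0.
rewrite commrMl; apply: (closedD (span_closed _)).
  move: (commr f l) IH; apply: (span_min (P := fun g => span _ (l' * g))).
    exact: (closed_preim (mul_linr l')) (span_closed _).
  by move=> g Pg; apply: span_gen; rewrite -addnA -addnS; apply: lie_prod_cons.
apply: span_gen; have -> : (d' + w + d).+1 = ((d' + d).+1 + w)%N by lia.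
by apply: lie_prod_cons => //; apply: lcomm_commr.
Qed.

Inductive odd_prod : nat -> nat -> R -> Prop :=
| odd_prod_nil : odd_prod 0 0 1
| odd_prod_cons d l n w f :
    odd d -> Lh d l -> odd_prod n w f -> odd_prod n.+1 (d + w) (l * f).

Lemma odd_prod_lie n w f : odd_prod n w f -> lie_prod n w f.
Proof. by elim=> *; [apply: lie_prod_nil|apply: lie_prod_cons]. Qed.

Lemma lie_prod_split n w f : lie_prod n w f -> odd_prod n w f \/
  exists n1 w1 u d l n2 w2 v, [/\ ~~ odd d, lie_prod n1 w1 u, Lh d l,
    lie_prod n2 w2 v & [/\ n = (n1 + n2).+1, w = (w1 + d + w2)%N & f = u * (l * v)]].
Proof.
elim=> [|d l {}n {}w {}f Ll Pf IH]; first by left; apply: odd_prod_nil.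
have [od|ed] := boolP (odd d); last first.
  right; exists 0, 0, 1, d, l, n, w, f; split=> //; first exact: lie_prod_nil.
  by split=> //; rewrite mul1r.
case: IH => [Of|[n1 [w1 [u [d' [l' [n2 [w2 [v [ed Pu Ll' Pv [-> -> ->]]]]]]]]]]].
  by left; apply: odd_prod_cons.
right; exists n1.+1, (d + w1)%N, (l * u), d', l', n2, w2, v; split=> //.
  exact: lie_prod_cons.
by rewrite !addnA mulrA.
Qed.

(** Strong induction on the number of factors. A factor [l] of even index is moved to the front,
    where [idc_mul_evenl] applies; the correction [[u,l]v] has fewer factors and a larger index. If
    all indices are odd, the first two factors together lie in an ideal of even index. *)
Lemma lie_prod_idc n w f : lie_prod n w f -> idc w f.
Proof.
elim/ltn_ind: n w f => n IH w f Pf; case: (lie_prod_split Pf) => {Pf}[Of|].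
  case: Of IH => [|d l {}n {}w {}f od Ll Of] IH; first exact: idc0.
  case: Of IH => [|d' l' {}n {}w {}f od' Ll' Of] IH.
    by rewrite mulr1 addn0; apply: LC_idc; apply: lcomm_LC Ll.
  rewrite mulrA addnA; apply: idc_mul_evenl => //; first by rewrite oddD od od'.
    exact: idc_letters_odd_odd.
  by apply: (IH n) => //; apply: odd_prod_lie.
move=> [n1 [w1 [u [d [l [n2 [w2 [v [ed Pu Ll Pv [En -> ->]]]]]]]]]].
have -> : u * (l * v) = l * (u * v) + commr u l * v.
  by rewrite /commr mulrBl !mulrA addrC subrK.
have n12 : (n1 + n2 < n)%N by rewrite En.
apply: (closedD (idc_closed _)).
  rewrite addnAC addnC; apply: idc_mul_evenl => //; last first.
    exact: IH n12 _ _ (lie_prod_cat Pu Pv).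
  by apply: LC_idc; apply: lcomm_LC Ll.
apply: idc_pred; move: (commr u l) (lie_prod_commr Pu Ll).
apply: (span_min (P := fun g => idc _ (g * v))).
  exact: (closed_preim (mul_linl v)) (idc_closed _).
by move=> g Pg; apply: IH n12 _ _ _; rewrite -addSn; apply: lie_prod_cat.
Qed.

End ThreeLetters.
End LowerCentral.

(** * Monoid algebras *)

Section LinearExtension.
Variables (K : fieldType) (J : choiceType).
Implicit Types (c : {malg K[J]}).

(** For values in the free algebra this is convertible to [lincomb], which later proofs exploit
    silently. *)
Definition lext (V : lmodType K) (h : J -> V) c : V :=
  \sum_(j <- msupp c) c@_j *: h j.

Variable V : lmodType K.
Implicit Types (h : J -> V).

Lemma lextEw h c (D : {fset J}) : (msupp c `<=` D)%fset ->
  lext h c = \sum_(j <- D) c@_j *: h j.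
Proof.
move=> sD; apply: big_fset_incl => // j _ /mcoeff_outdom ->.
by rewrite scale0r.
Qed.

Lemma lext_lin h a c d : lext h (a *: c + d) = a *: lext h c + lext h d.
Proof.
pose D := (msupp c `|` msupp d `|` msupp (a *: c + d))%fset.
have sc : (msupp c `<=` D)%fset by rewrite /D -fsetUA fsubsetUl.
have sd : (msupp d `<=` D)%fset by rewrite /D fsetUAC fsubsetUr.
have scd : (msupp (a *: c + d) `<=` D)%fset by rewrite /D fsubsetUr.
rewrite (lextEw h sc) (lextEw h sd) (lextEw h scd) scaler_sumr -big_split.
by apply: eq_bigr => j _; rewrite mcoeffD mcoeffZ scalerDl scalerA.
Qed.

Lemma lext0 h : lext h 0 = 0.
Proof. by rewrite /lext msupp0 big_nil. Qed.

Lemma lextZ h a c : lext h (a *: c) = a *: lext h c.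
Proof. by rewrite -[_ *: c]addr0 lext_lin lext0 addr0. Qed.

Lemma lextD h c d : lext h (c + d) = lext h c + lext h d.
Proof. by rewrite -[c]scale1r lext_lin !scale1r. Qed.

Lemma lextN h c : lext h (- c) = - lext h c.
Proof. by rewrite -[- c]scaleN1r lextZ scaleN1r. Qed.

Lemma lextB h c d : lext h (c - d) = lext h c - lext h d.
Proof. by rewrite lextD lextN. Qed.

Lemma lextU h j : lext h << j >> = h j.
Proof. by rewrite /lext msuppU oner_eq0 big_seq_fset1 mcoeffUU scale1r. Qed.

Lemma eq_lext h h' c : {in msupp c, h =1 h'} -> lext h c = lext h' c.
Proof. by move=> E; apply: eq_big_seq => j /E ->. Qed.

Lemma lext_closed (P : V -> Prop) h c : lin_closed P ->
  (forall j, j \in msupp c -> P (h j)) -> P (lext h c).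
Proof.
by move=> cP Ph; apply: (closed_sum cP) => j /Ph; apply: closedZ.
Qed.

Lemma lext_linl h h' a c :
  lext (fun j => a *: h j + h' j) c = a *: lext h c + lext h' c.
Proof.
rewrite /lext scaler_sumr -big_split; apply: eq_bigr => j _ /=.
by rewrite scalerDr !scalerA mulrC.
Qed.

Lemma malgE c : lext (fun j => << j >>) c = c.
Proof.
rewrite [RHS]monalgE; apply: eq_bigr => j _; apply/malgP => k.
by rewrite mcoeffZ !mcoeffU mulrnAr mulr1.
Qed.

End LinearExtension.

Lemma malg_ind (K : fieldType) (J : choiceType) (P : {malg K[J]} -> Prop) :
  lin_closed P -> (forall j, P << j >>) -> forall c, P c.
Proof. by move=> cP PU c; rewrite -(malgE c); apply: lext_closed. Qed.

Lemma malg_ext (K : fieldType) (J : choiceType) (V : lmodType K)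
    (f g : {malg K[J]} -> V) :
  (forall a c d, f (a *: c + d) = a *: f c + f d) ->
  (forall a c d, g (a *: c + d) = a *: g c + g d) ->
  (forall j, f << j >> = g << j >>) -> f =1 g.
Proof.
move=> fl gl E; apply: malg_ind => //.
have c0 h : (forall a (c d : {malg K[J]}), h (a *: c + d) = a *: h c + h d :> V) -> h 0 = 0.
  by move=> hl; have := hl (-1) 0 0; rewrite scaler0 add0r scaleN1r addNr.
by split=> [|a c d Ec Ed]; [rewrite !c0 | rewrite fl gl Ec Ed].
Qed.

Lemma lext_comp (K : fieldType) (J : choiceType) (V W : lmodType K) (f : V -> W)
    (h : J -> V) :
  (forall a u v, f (a *: u + v) = a *: f u + f v) ->
  forall c, f (lext h c) = lext (fun j => f (h j)) c.
Proof.
move=> fl; apply: malg_ext => [a c d|a c d|j].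
- by rewrite lext_lin fl.
- by rewrite lext_lin.
- by rewrite !lextU.
Qed.

Section MonoidAlgebra.
Variables (K : fieldType) (M : monomType).

Lemma malgUM (m m' : M) : << m >> * << m' >> = << mmul m m' >> :> {malg K[M]}.
Proof. by rewrite malgM_def fgmulUU mul1r. Qed.

Lemma malgZU (a b : K) (m : M) : a *: << b *g m >> = << a * b *g m >> :> {malg K[M]}.
Proof. by apply/malgP => k; rewrite mcoeffZ !mcoeffU mulrnAr. Qed.

Lemma malg_scalerAr (a : K) (f g : {malg K[M]}) : a *: (f * g) = f * (a *: g).
Proof.
rewrite (malgMEw (fsubset_refl _) (msuppZ_le a g)) malgME scaler_sumr.
apply: eq_bigr => k _; rewrite scaler_sumr; apply: eq_bigr => k' _.
by rewrite mcoeffZ malgZU mulrCA.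
Qed.

End MonoidAlgebra.

(** * Evaluation homomorphisms of the free algebra *)

Section Evaluation.
Variables (K : fieldType) (I : choiceType) (B : lalgType K).
Hypothesis scalerAr : forall (c : K) (a b : B), c *: (a * b) = a * (c *: b).
Variable a : I -> B.

Definition evalm (f : {malg K[{fmonom I}]}) : B :=
  lext (fun w : {fmonom I} => \prod_(i <- w) a i) f.

Lemma evalm_lin c f g : evalm (c *: f + g) = c *: evalm f + evalm g.
Proof. exact: lext_lin. Qed.

Lemma evalmM f g : evalm (f * g) = evalm f * evalm g.
Proof.
move: f; apply: malg_ext => [c f f'|c f f'|w].
- by rewrite mulrDl -scalerAl evalm_lin.
- by rewrite evalm_lin mulrDl -scalerAl.
move: g; apply: malg_ext => [c g g'|c g g'|w'].
- by rewrite mulrDr -malg_scalerAr evalm_lin.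
- by rewrite evalm_lin mulrDr -scalerAr.
by rewrite malgUM /evalm (lextU _ (mmul w w')) (lextU _ w) (lextU _ w') fmM big_cat.
Qed.

Lemma evalm1 : evalm 1 = 1.
Proof. by rewrite /evalm lextU fm1 big_nil. Qed.

Lemma evalmU i : evalm << fmu i >> = a i.
Proof. by rewrite /evalm lextU fmU big_seq1. Qed.

Lemma evalm_commr f g : evalm (commr f g) = commr (evalm f) (evalm g).
Proof.
exact: etrans (lextB _ _ _) (congr2 (fun u v => u - v) (evalmM f g) (evalmM g f)).
Qed.

End Evaluation.

(** * The action of a Lie algebra on sorted words *)

Section PBWAction.
Variables (K : fieldType) (d : Order.disp_t) (I : orderType d).
Variable br : I -> I -> {malg K[I]}.
Hypothesis br_alt : forall i, br i i = 0.
Hypothesis br_anti : forall i j, br i j = - br j i.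
Hypothesis br_jacobi : forall i j k,
  lext (br i) (br j k) - lext (br j) (br i k) = lext (fun l => br l k) (br i j).

Local Notation M := {malg K[seq I]}.
Local Notation srt := (sort <=%O).
Implicit Types (i j k l : I) (w : seq I) (m : M) (c : {malg K[I]}).

Definition sorted_bounded n m : Prop :=
  forall w, w \in msupp m -> sorted <=%O w && (size w <= n)%N.

Lemma sorted_bounded_closed n : lin_closed (sorted_bounded n).
Proof.
split=> [w|c f g Sf Sg w]; first by rewrite msupp0 inE.
move=> /(fsubsetP (msuppD_le _ _)); rewrite inE => /orP[|]; last exact: Sg.
by move=> /(fsubsetP (msuppZ_le _ _)); apply: Sf.
Qed.

Lemma sorted_boundedU n w : sorted <=%O w -> (size w <= n)%N -> sorted_bounded n << w >>.
Proof. by move=> sw nw v; rewrite msuppU oner_eq0 inE => /eqP ->; rewrite sw. Qed.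

Lemma sorted_boundedW n n' m : (n <= n')%N -> sorted_bounded n m -> sorted_bounded n' m.
Proof. by move=> le Sm w /Sm /andP[-> /= h]; apply: leq_trans le. Qed.

Lemma sort_consE i w : sorted <=%O (i :: w) -> srt (i :: w) = i :: w.
Proof. exact: (sorted_sort le_trans). Qed.

Lemma sort_sortedO w : sorted <=%O (srt w).
Proof. exact: sort_sorted le_total w. Qed.

Lemma sort_swap i j w : sorted <=%O (j :: w) -> (j <= i)%O ->
  srt (i :: j :: w) = j :: srt (i :: w).
Proof.
move=> sw ji; apply: (sorted_eq le_trans le_anti); first exact: sort_sortedO.
  rewrite /= path_min_sorted ?sort_sortedO //.
  rewrite all_sort /= ji; exact: (order_path_min le_trans sw).
rewrite perm_sort -(perm_cat2r [::] [:: i, j & w]) !cats0.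
rewrite -[i :: _]/([:: i] ++ [:: j] ++ w) perm_catCA /= perm_cons.
by rewrite perm_sym perm_sort.
Qed.

(* Fuelled by an upper bound n on the size of w. *)
Fixpoint act (n : nat) (i : I) (w : seq I) : M :=
  match n, w with
  | n'.+1, j :: w' =>
      if (i <= j)%O then << i :: w >> else
      << srt (i :: w) >> + lext (act n' j) (act n' i w' - << srt (i :: w') >>)
        + lext (fun k => act n' k w') (br i j)
  | _, _ => << i :: w >>
  end.

(** This justifies the recursion in [act], whose rule for [j < i] is [i(jw) = j(iw) + [i,j]w]. The
    leading word of [iw] is its sorted word, on which [j] merely prepends; with that word split off,
    [j] is applied only to words no longer than [w]. *)
Lemma act_low n i w : sorted <=%O w -> (size w <= n)%N ->
  sorted_bounded (size w) (act n i w - << srt (i :: w) >>).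
Proof.
elim: n i w => [|n IH] i [|j w] sw //= sn; have cS p := sorted_bounded_closed p.
- by rewrite subrr; apply: closed0 (cS _).
- by rewrite subrr; apply: closed0 (cS _).
have sw' : sorted <=%O w by apply: path_sorted sw.
case: ifP => ij; first by rewrite sort_consE /= ?ij // subrr; apply: closed0 (cS _).
have hi k v : sorted <=%O v -> (size v <= size w)%N ->
    sorted_bounded (size w).+1 (act n k v).
  move=> sv vw; rewrite -[act n k v](subrK << srt (k :: v) >>).
  apply: (closedD (cS _)).
    by apply: sorted_boundedW (IH k v sv (leq_trans vw sn)); apply: leqW.
  by apply: sorted_boundedU; rewrite ?sort_sortedO // size_sort.
rewrite -[<< _ >> + _ + _]addrA [<< _ >> + _]addrC addrK; apply: (closedD (cS _)).
  by apply: lext_closed (cS _) _ => v /(IH i w sw' sn) /andP[]; apply: hi.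
by apply: lext_closed (cS _) _ => k _; apply: hi.
Qed.

Lemma act_nil n i : act n i [::] = << [:: i] >>.
Proof. by case: n. Qed.

Lemma act_cons n i j w : act n.+1 i (j :: w) =
  if (i <= j)%O then << i :: j :: w >> else
    << srt (i :: j :: w) >> + lext (act n j) (act n i w - << srt (i :: w) >>)
      + lext (fun k => act n k w) (br i j).
Proof. by []. Qed.

Lemma act_fuel n n' i w : sorted <=%O w -> (size w <= n)%N -> (size w <= n')%N ->
  act n i w = act n' i w.
Proof.
elim: n n' i w => [|n IH] n' i w sw.
  by rewrite leqn0 => /nilP -> _; rewrite !act_nil.
case: w sw => [|j w] sw; first by rewrite !act_nil.
case: n' => [|n'] sn sn'; first by rewrite ltn0 in sn'.
have sw' : sorted <=%O w by apply: path_sorted sw.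
rewrite !act_cons; case: (i <= j)%O; first by [].
rewrite (IH n' i w sw' sn sn').
rewrite (@eq_lext _ _ _ _ (act n' j)); last first.
  move=> v /(act_low sw' sn') /andP[sv vw].
  exact: IH sv (leq_trans vw sn) (leq_trans vw sn').
rewrite (@eq_lext _ _ _ (fun k => act n k w) (fun k => act n' k w)); first by [].
move=> k _; exact: IH sw' sn sn'.
Qed.

Definition opI i m : M := lext (fun w => act (size w) i w) m.
Definition opL c m : M := lext (fun k => opI k m) c.

Lemma opI_lin i a u v : opI i (a *: u + v) = a *: opI i u + opI i v.
Proof. exact: lext_lin. Qed.

Lemma opID i u v : opI i (u + v) = opI i u + opI i v.
Proof. exact: lextD. Qed.

Lemma opIB i u v : opI i (u - v) = opI i u - opI i v.
Proof. exact: lextB. Qed.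

Lemma opL_linl a c c' m : opL (a *: c + c') m = a *: opL c m + opL c' m.
Proof. exact: lext_lin. Qed.

Lemma opL_linr c a u v : opL c (a *: u + v) = a *: opL c u + opL c v.
Proof.
by rewrite /opL -lext_linl; apply: eq_lext => k _; rewrite opI_lin.
Qed.

Lemma opLU i m : opL << i >> m = opI i m.
Proof. exact: lextU. Qed.

Lemma opLB c c' m : opL (c - c') m = opL c m - opL c' m.
Proof. exact: lextB. Qed.

Lemma opI_min i w : sorted <=%O (i :: w) -> opI i << w >> = << i :: w >>.
Proof. by rewrite /opI lextU; case: w => [|j w] //= /andP[-> _]. Qed.

Lemma opI_low i w : sorted <=%O w ->
  sorted_bounded (size w) (opI i << w >> - << srt (i :: w) >>).
Proof. by move=> sw; rewrite /opI lextU; apply: act_low. Qed.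

Lemma opI_swap i j w : sorted <=%O (j :: w) -> (j < i)%O ->
  opI i << j :: w >> = opI j (opI i << w >>) + opL (br i j) << w >>.
Proof.
move=> sw ji; have sw' : sorted <=%O w by apply: path_sorted sw.
have E0 : opI i << w >> = act (size w) i w by rewrite /opI lextU.
have E1 : opI i << j :: w >> = act (size w).+1 i (j :: w) by rewrite /opI lextU.
rewrite E1 act_cons (lt_geF ji); lazy iota; rewrite -E0.
rewrite (@eq_lext _ _ _ (act (size w) j) (fun v => act (size v) j v)); last first.
  move=> v; rewrite E0 => /(act_low sw' (leqnn _)) /andP[sv vw].
  by apply: act_fuel.
(* The sorted word that [act] splits off is [j] applied to the leading word of [iw], so both pieces
   recombine into [opI j (opI i w)]. *)
rewrite -/(opI j _) (sort_swap sw (ltW ji)) -opI_min; last first.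
  rewrite [sorted _ _]path_min_sorted ?sort_sortedO // all_sort /= (ltW ji).
  exact: (order_path_min le_trans sw).
rewrite opIB [opI j << _ >> + _]addrC addrNK /opL.
rewrite [in RHS](@eq_lext _ _ _ _ (fun k => act (size w) k w)); first by [].
by move=> k _; rewrite /opI lextU.
Qed.

Definition comm_at i j m := opI i (opI j m) - opI j (opI i m) = opL (br i j) m.

Lemma comm_at_closed i j : lin_closed (comm_at i j).
Proof.
split=> [|a u v Cu Cv]; rewrite /comm_at.
  rewrite /opI !lext0 subrr /opL.
  by rewrite /lext big1 // => k _; rewrite /opI lext0 scaler0.
by rewrite !opI_lin opL_linr -Cu -Cv scalerBr opprD addrACA.
Qed.

Lemma comm_at_min i j w : sorted <=%O (j :: w) -> (j < i)%O -> comm_at i j << w >>.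
Proof.
by move=> sw ji; rewrite /comm_at (opI_min sw) (opI_swap sw ji) addrC addKr.
Qed.

Lemma comm_atC i j m : comm_at i j m -> comm_at j i m.
Proof.
by rewrite /comm_at -opprB => E; rewrite (br_anti j) /opL lextN -/(opL _ _) -E opprK.
Qed.

(** The core of the PBW theorem, by induction on length. If [w] is empty, or if [i] or [j] does not
    exceed its head [k], the relation is the defining rule of the action. Otherwise both operators
    are passed through [k], and the Jacobi identity for [i, j, k] matches the remaining terms. *)
Lemma comm_at_sorted n w i j : sorted <=%O w -> (size w <= n)%N -> comm_at i j << w >>.
Proof.
elim: n w i j => [|n IH] w i j sw wn.
  case: w sw wn => // _ _; case: (ltgtP i j) => [ij|ji|->].
  - exact/comm_atC/comm_at_min.
  - exact/comm_at_min.
  - by rewrite /comm_at br_alt /opL lext0 subrr.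
case: (eqVneq i j) => [->|Nij]; first by rewrite /comm_at br_alt /opL lext0 subrr.
case: w sw wn => [|k w] sw wn.
  case: (ltgtP i j) Nij => [ij|ji|->] // _; [exact/comm_atC/comm_at_min|exact/comm_at_min].
case: (leP i k) => ik.
  case: (ltgtP i j) Nij => [ij|ji|->] // _; first by apply/comm_atC/comm_at_min => //=; rewrite ik.
  by apply: comm_at_min => //=; rewrite (le_trans (ltW ji)).
case: (leP j k) => jk.
  by apply: comm_at_min; rewrite /= ?jk // (le_lt_trans jk).
have {}wn : (size w <= n)%N by [].
have sw' : sorted <=%O w by apply: path_sorted sw.
have IHm m i' j' : sorted_bounded n m -> comm_at i' j' m.
  move=> Sm; rewrite -(malgE m); apply: (lext_closed (comm_at_closed i' j')) => v.
  by move=> /Sm /andP[]; apply: IH.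
pose m : M := << w >>.
have Sm : sorted_bounded n m by apply: sorted_boundedU.
have Ek i' : (k < i')%O -> opI i' << k :: w >> = opI k (opI i' m) + opL (br i' k) m.
  exact: opI_swap.
(* the commutation with k at opI j' m: k precedes the leading word of opI j' m *)
have Ckk i' j' : (k < i')%O -> (k < j')%O -> 
    opI i' (opI k (opI j' m)) = opI k (opI i' (opI j' m)) + opL (br i' k) (opI j' m).
  move=> ki kj; apply/eqP; rewrite addrC -subr_eq; apply/eqP.
  change (comm_at i' k (opI j' m)).
  rewrite -[opI j' m](subrK << srt (j' :: w) >>); apply: (closedD (comm_at_closed _ _)).
    by apply: IHm; apply: sorted_boundedW wn _; apply: opI_low.
  apply: comm_at_min => //=; rewrite path_min_sorted ?sort_sortedO // all_sort /=.
  by rewrite (ltW kj); apply: (order_path_min le_trans sw).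
have CL i' c : opI i' (opL c m) = opL c (opI i' m) + opL (lext (br i') c) m.
  move: c; apply: malg_ext => [a c c'|a c c'|l].
  - by rewrite opL_linl opI_lin.
  - rewrite lext_lin !opL_linl scalerDr addrACA //.
  rewrite !opLU lextU; apply/eqP; rewrite addrC -subr_eq; apply/eqP; exact: IHm.
rewrite /comm_at !Ek //.
rewrite !opID !Ckk // !CL.
(* The bracket [[i,j]] too is passed through [k], which is minimal and hence prepends to [w]. *)
have Ck : opL (br i j) << k :: w >> =
    opI k (opL (br i j) m) + opL (lext (fun l => br l k) (br i j)) m.
  rewrite -(opI_min sw) CL -addrA -[LHS]addr0; congr (_ + _).
  rewrite /opL -lextD -/(opL _ _).
  have -> : lext (br k) (br i j) + lext (fun l => br l k) (br i j) = 0.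
    rewrite [X in _ + X](@eq_lext _ _ _ _ (fun l => -1 *: br k l + 0)); last first.
      by move=> l _; rewrite br_anti scaleN1r addr0.
    rewrite lext_linl scaleN1r addrA subrr add0r.
    by rewrite /lext big1 // => ? _; rewrite scaler0.
  by rewrite /opL lext0.
rewrite Ck -br_jacobi opLB -(IHm m i j Sm).
have -> : opI k (opI i (opI j m) - opI j (opI i m)) =
    opI k (opI i (opI j m)) - opI k (opI j (opI i m)) by rewrite /opI lextB.
set X1 := opI k _; set X2 := opI k _.
set Y1 := opL (br i k) _; set Y2 := opL (br j k) _.
set Z1 := opL _ m; set Z2 := opL _ m.
clearbody X1 X2 Y1 Y2 Z1 Z2.
rewrite (addrC Y2) (addrC Y1 Z2) (addrACA X1) (addrACA X2) (addrC Y2).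
by rewrite opprD (addrACA (X1 + Z1)) subrr addr0 opprD (addrACA X1).
Qed.

Definition sorted_supp m : Prop := forall w, w \in msupp m -> sorted <=%O w.

Lemma sorted_supp_closed : lin_closed sorted_supp.
Proof.
split=> [w|c f g Sf Sg w]; first by rewrite msupp0 inE.
move=> /(fsubsetP (msuppD_le _ _)); rewrite inE => /orP[|]; last exact: Sg.
by move=> /(fsubsetP (msuppZ_le _ _)); apply: Sf.
Qed.

Lemma sorted_suppU w : sorted <=%O w -> sorted_supp << w >>.
Proof. by move=> sw v; rewrite msuppU oner_eq0 inE => /eqP ->. Qed.

Lemma opL_sorted_supp c m : sorted_supp m -> sorted_supp (opL c m).
Proof.
move=> Sm; apply: lext_closed sorted_supp_closed _ => i _.
apply: lext_closed sorted_supp_closed _ => w /Sm sw.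
rewrite -[act _ _ _](subrK << srt (i :: w) >>); apply: (closedD sorted_supp_closed).
  by move=> v /(act_low sw (leqnn _)) /andP[].
by apply: sorted_suppU; apply: sort_sortedO.
Qed.

Lemma opL_commr c c' m : sorted_supp m ->
  opL c (opL c' m) - opL c' (opL c m) = opL (lext (fun i => lext (br i) c') c) m.
Proof.
have subl (V : lmodType K) a (u v u' v' : V) :
    a *: u + v - (a *: u' + v') = a *: (u - u') + (v - v').
  by rewrite scalerBr opprD addrACA.
move=> Sm; move: c; apply: malg_ext => [a c c2|a c c2|i].
- by rewrite !opL_linl opL_linr subl.
- by rewrite lext_lin opL_linl.
move: c'; apply: malg_ext => [a c c2|a c c2|j].
- by rewrite !opL_linl opL_linr subl.
- by rewrite !lextU lext_lin opL_linl.
rewrite !opLU !lextU -/(comm_at i j m) -(malgE m).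
apply: (lext_closed (comm_at_closed i j)) => w /Sm sw.
exact: comm_at_sorted sw (leqnn _).
Qed.

End PBWAction.

(** * Uniqueness of regular expansions *)

Section FreeAlgebraClosures.
Variable K : fieldType.
Local Notation F := (freeF K).
Implicit Types (f g : F) (c : K).

Lemma submod_closedP (S : set F) : GRing.submod_closed [in S] <-> lin_closed S.
Proof.
split=> [[S0 SD]|[S0 SD]]; split.
- by move: S0; rewrite inE.
- by move=> c f g Sf Sg; have := SD c f g; rewrite !inE; apply.
- by rewrite inE.
- by move=> c f g; rewrite !inE; apply: SD.
Qed.

Lemma zmod_closedP (S : set F) : lin_closed S -> GRing.zmod_closed [in S].
Proof.
move=> cS; split; first by rewrite inE; apply: closed0 cS.
by move=> f g; rewrite !inE; apply: closedB.
Qed.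

Lemma L3_commr f g : L3 f -> L3 g -> L3 (commr f g).
Proof. by move=> Lf Lg S SX; apply: SX.1.2; [apply: Lf | apply: Lg]. Qed.

Lemma L3_fvar i : (i < 3)%N -> L3 (fvar K i).
Proof.
move=> i3 S [_]; apply; move: i i3 => [|[|[|]]] // _.
- by left; left.
- by left; right.
- by right.
Qed.

Lemma L3_ind (P : F -> Prop) : lin_closed P ->
  (forall f g, P f -> P g -> P (commr f g)) -> (forall i, (i < 3)%N -> P (fvar K i)) ->
  forall f, L3 f -> P f.
Proof.
move=> cP Pc PX f; apply; split; first by split=> //; apply/submod_closedP.
by move=> _ [[->|->]|->]; apply: PX.
Qed.

Lemma F3_ind (P : F -> Prop) : lin_closed P -> P 1 ->
  (forall f g, P f -> P g -> P (f * g)) -> (forall i, (i < 3)%N -> P (fvar K i)) ->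
  forall f, F3 f -> P f.
Proof.
move=> cP P1 PM PX f; apply; split; last by move=> _ [[->|->]|->]; apply: PX.
split; first by rewrite inE.
- by move=> c g h; rewrite !inE; apply: cP.2.
- by move=> g h; rewrite !inE; apply: PM.
Qed.

End FreeAlgebraClosures.

Section RegularWords.
Variables (K : fieldType) (d : Order.disp_t) (I : orderType d) (e : I -> freeF K).
Hypothesis e_basis : is_lie_basis e.
Local Notation F := (freeF K).
Implicit Types (i j k : I) (c : {malg K[I]}) (f g : F).

Lemma lie_basis_L3 c : L3 (lincomb e c).
Proof. by rewrite -(lie_basis_span e_basis); exists c. Qed.

Lemma L3_lincomb f : L3 f -> exists c, lincomb e c = f.
Proof. by rewrite -(lie_basis_span e_basis) => -[c _ <-]; exists c. Qed.

Lemma lie_basis_L3i i : L3 (e i).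
Proof. by rewrite -[e i](lextU e); apply: lie_basis_L3. Qed.

Definition coords f : {malg K[I]} := xget 0 [set c | lincomb e c = f].

Lemma coordsK f : L3 f -> lincomb e (coords f) = f.
Proof. by move=> /L3_lincomb Lf; apply: (xgetPex 0 Lf). Qed.

Definition bracket i j : {malg K[I]} := coords (commr (e i) (e j)).

Lemma bracketK i j : lext e (bracket i j) = commr (e i) (e j).
Proof. by apply: coordsK; apply: L3_commr; apply: lie_basis_L3i. Qed.

Lemma free_scalerAr (a : K) (f g : F) : a *: (f * g) = f * (a *: g).
Proof. exact: malg_scalerAr. Qed.

Lemma lext_bracketr i c : lext e (lext (bracket i) c) = commr (e i) (lext e c).
Proof.
move: c; apply: malg_ext => [a c c'|a c c'|j].
- by rewrite !lext_lin.
- by rewrite lext_lin (commr_linr free_scalerAr).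
- by rewrite !lextU bracketK.
Qed.

Lemma lext_bracketl c j :
  lext e (lext (fun i => bracket i j) c) = commr (lext e c) (e j).
Proof.
move: c; apply: malg_ext => [a c c'|a c c'|i].
- by rewrite !lext_lin.
- by rewrite lext_lin (commr_linl free_scalerAr).
- by rewrite !lextU bracketK.
Qed.

Lemma lext_bracket c c' :
  lext e (lext (fun i => lext (bracket i) c') c) = commr (lext e c) (lext e c').
Proof.
move: c; apply: malg_ext => [a c c2|a c c2|i].
- by rewrite !lext_lin.
- by rewrite lext_lin (commr_linl free_scalerAr).
- by rewrite !lextU lext_bracketr.
Qed.

Lemma bracket_alt i : bracket i i = 0.
Proof.
apply: (lie_basis_free e_basis); rewrite [LHS]bracketK /commr subrr.
by rewrite [RHS]lext0.
Qed.

Lemma bracket_anti i j : bracket i j = - bracket j i.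
Proof.
apply: (lie_basis_free e_basis); rewrite [LHS]bracketK [RHS]lextN bracketK.
exact: commrC.
Qed.

Lemma bracket_jacobi i j k :
  lext (bracket i) (bracket j k) - lext (bracket j) (bracket i k)
    = lext (fun l => bracket l k) (bracket i j).
Proof.
have E1 : lext e (lext (bracket i) (bracket j k)) = commr (e i) (commr (e j) (e k)).
  by rewrite -bracketK; apply: lext_bracketr.
have E2 : lext e (lext (bracket j) (bracket i k)) = commr (e j) (commr (e i) (e k)).
  by rewrite -bracketK; apply: lext_bracketr.
have E3 : lext e (lext (fun l => bracket l k) (bracket i j)) =
    commr (commr (e i) (e j)) (e k).
  by rewrite -bracketK; apply: lext_bracketl.
apply: (lie_basis_free e_basis).
have E : lext e (lext (bracket i) (bracket j k) - lext (bracket j) (bracket i k))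
    = lext e (lext (fun l => bracket l k) (bracket i j)); last exact: E.
rewrite lextB; apply: etrans (esym E3).
apply: etrans (congr2 (fun u v => u - v) E1 E2) _; exact: commr_derivation.
Qed.

Local Notation opB := (opL bracket).
Local Notation M := {malg K[seq I]}.

(** Freeness lets each letter act by any operator: [x, y, z] act through their coordinates in [L3],
    all other letters by zero. *)
Definition lie_rep f (m : M) : M :=
  lext (fun w : {fmonom nat} =>
    foldr (fun s => opB (if (s < 3)%N then coords (fvar K s) else 0)) m w) f.

Lemma lie_rep_linl m a f g : lie_rep (a *: f + g) m = a *: lie_rep f m + lie_rep g m.
Proof. exact: lext_lin. Qed.

Lemma lie_rep_linr f a u v : lie_rep f (a *: u + v) = a *: lie_rep f u + lie_rep f v.
Proof.
rewrite /lie_rep -lext_linl; apply: eq_lext => w _.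
by elim: (w : seq nat) => //= s r ->; rewrite opL_linr.
Qed.

Lemma lie_rep1 m : lie_rep 1 m = m.
Proof. by rewrite /lie_rep lextU fm1. Qed.

Lemma lie_repM f g m : lie_rep (f * g) m = lie_rep f (lie_rep g m).
Proof.
move: f; apply: malg_ext => [a f f'|a f f'|w].
- by rewrite mulrDl -scalerAl lie_rep_linl.
- by rewrite lie_rep_linl.
move: g; apply: malg_ext => [a g g'|a g g'|w'].
- by rewrite mulrDr -free_scalerAr lie_rep_linl.
- by rewrite lie_rep_linl lie_rep_linr.
by rewrite malgUM /lie_rep !lextU fmM foldr_cat.
Qed.

Lemma lie_rep_L3 f : L3 f ->
  forall m, sorted_supp m -> lie_rep f m = opB (coords f) m.
Proof.
(* The coordinates are kept existential so that induction over [L3] can bracket them; independence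
   of the basis identifies them with [coords f] afterwards. *)
pose P f := exists2 c, lext e c = f & forall m, sorted_supp m -> lie_rep f m = opB c m.
suff h g : L3 g -> P g.
  move=> Lf m Sm; have [c Ec ->] := h f Lf; last by [].
  congr (opB _ _); apply: (lie_basis_free e_basis).
  by rewrite coordsK.
apply: L3_ind.
- split.
    exists 0; first exact: lext0.
    by move=> m Sm; rewrite /lie_rep /opL !lext0.
  move=> a {}f {}g [c Hf Ec] [c' Hg Ec']; exists (a *: c + c').
    by rewrite -Hf -Hg; apply: lext_lin.
  by move=> m Sm; rewrite lie_rep_linl opL_linl (Ec m Sm) (Ec' m Sm).
- move=> {}f {}g [c Hf Ec] [c' Hg Ec'].
  exists (lext (fun i => lext (bracket i) c') c).
    by rewrite -Hf -Hg; apply: lext_bracket.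
  move=> m Sm.
  have <- : opB c (opB c' m) - opB c' (opB c m)
      = opB (lext (fun i => lext (bracket i) c') c) m.
    apply: opL_commr Sm; [exact: bracket_alt|exact: bracket_anti|].
    exact: bracket_jacobi.
  have Sf : sorted_supp (opB c m) by apply: opL_sorted_supp.
  have Sg : sorted_supp (opB c' m) by apply: opL_sorted_supp.
  rewrite -(Ec _ Sg) -(Ec' _ Sf) -(Ec _ Sm) -(Ec' _ Sm) -!lie_repM.
  exact: lextB.
- move=> s s3; exists (coords (fvar K s)); first by apply: coordsK; apply: L3_fvar.
  by move=> m Sm; rewrite /lie_rep lextU fmU /= s3.
Qed.

(** The factors act from right to left, and each index is minimal for the word built so far, so it
    is simply prepended. *)
Lemma lie_rep_word v : regular v -> lie_rep (word_val e v) << [::] >> = << v >>.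
Proof.
elim: v => [|i v IH] sv; first by rewrite /word_val big_nil lie_rep1.
have sv' : regular v by apply: path_sorted sv.
rewrite /word_val big_cons lie_repM -/(word_val e v) (IH sv').
rewrite (lie_rep_L3 (lie_basis_L3i i)); last exact: sorted_suppU.
have -> : coords (e i) = << i >>.
  apply: (lie_basis_free e_basis).
  by rewrite [LHS]coordsK ?[RHS]lextU //; apply: lie_basis_L3i.
by rewrite opLU opI_min.
Qed.

Lemma regular_expansion_inj f (b b' : {malg K[seq I]}) :
  regular_expansion e f b -> regular_expansion e f b' -> b = b'.
Proof.
have h a : regular_expansion e f a -> lie_rep f << [::] >> = a.
  case=> ra <-; rewrite -[RHS]malgE; apply: etrans (lext_comp _ _ a) _.
    by move=> *; apply: lie_rep_linl.
  by apply: eq_lext => v /ra; apply: lie_rep_word.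
by move=> /h <- /h.
Qed.

End RegularWords.

(** * The weight filtration *)

Section Homogeneous.
Variable K : fieldType.
Local Notation F := (freeF K).
Implicit Types (f g : F).

Definition hom (D : nat) : F -> Prop :=
  span (fun g => exists2 w : {fmonom nat}, size w = D & g = << w >>).

Definition hom_comp (D : nat) f : F :=
  lext (fun w : {fmonom nat} => if size w == D then << w >> : F else 0) f.

Lemma hom_comp_lin D a f g : hom_comp D (a *: f + g) = a *: hom_comp D f + hom_comp D g.
Proof. exact: lext_lin. Qed.

Lemma homogF_hom f : homogF f -> hom (degF f) f.
Proof.
move=> hf; rewrite -{2}(malgE f).
apply: (lext_closed (span_closed _)) => w wf.
by apply: span_gen; exists w => //; apply: hf.
Qed.

Lemma homM D D' f g : hom D f -> hom D' g -> hom (D + D') (f * g).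
Proof.
move=> hf hg; move: f hf; apply: span_min.
  exact: (closed_preim (mul_linl g)) (span_closed _).
move=> _ [w sw ->]; move: g hg; apply: span_min.
  exact: (closed_preim (mul_linr (@free_scalerAr K) _)) (span_closed _).
move=> _ [w' sw' ->]; apply: span_gen; exists (mmul w w'); last exact: malgUM.
by rewrite fmM size_cat sw sw'.
Qed.

Lemma hom_commr D D' f g : hom D f -> hom D' g -> hom (D + D') (commr f g).
Proof.
move=> hf hg; apply: (closedB (span_closed _)); first exact: homM.
by rewrite addnC; apply: homM.
Qed.

Lemma hom_compE D D' f : hom D f -> hom_comp D' f = if D == D' then f else 0.
Proof.
move: f; apply: span_min => [|_ [w <- ->]]; last first.
  by apply: etrans (lextU _ _) _.
split=> [|a f g Ef Eg]; first by case: ifP => _; apply: lext0.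
rewrite hom_comp_lin Ef Eg; case: (D == D'); first by [].
by rewrite scaler0 addr0.
Qed.

Definition letter (i : 'I_3) : F := fvar K i.

Local Notation Lh := (lcomm (fun a => exists i, a = letter i)).

Lemma lcomm_letter_hom k f : Lh k f -> hom k.+1 f.
Proof.
elim: k f => [|k IH] f.
  apply: lcomm0_ind; first exact: span_closed.
  by move=> _ [i ->]; apply: span_gen; exists (fmu (i : nat)); rewrite ?fmU.
apply: lcommS_ind; first exact: span_closed.
move=> l _ /IH hl [i ->]; rewrite -[k.+2]addn1; apply: hom_commr => //.
by apply: span_gen; exists (fmu (i : nat)); rewrite ?fmU.
Qed.

Lemma L3_lcomm_letter f : L3 f -> span (fun g => exists k, Lh k g) f.
Proof.
move: f; apply: L3_ind => [|f g sf sg|i i3]; first exact: span_closed.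
  move: f sf; apply: span_min.
    exact: (closed_preim (commr_linl (@free_scalerAr K) _)) (span_closed _).
  move=> f [k Lf]; move: g sg; apply: span_min.
    exact: (closed_preim (commr_linr (@free_scalerAr K) _)) (span_closed _).
  move=> g [k' Lg]; apply: span_gen; exists (k + k').+1.
  exact: (lcomm_commr (@free_scalerAr K)).
apply: span_gen; exists 0; apply: span_gen; by exists (Ordinal i3).
Qed.

(** [L3] is spanned by commutators of letters, each homogeneous of degree its length, so the
    projection keeps exactly those of length [D]. At [D = 0] none is left and the component is
    zero. *)
Lemma hom_comp_L3 D f : L3 f -> Lh D.-1 (hom_comp D f).
Proof.
move=> /L3_lcomm_letter; move: f; apply: span_min.
  exact: (closed_preim (hom_comp_lin D)) (lcomm_closed _ _).
move=> f [k Lf]; rewrite (hom_compE D (lcomm_letter_hom Lf)).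
by case: eqP => [<-|_] //; apply: closed0 (lcomm_closed _ _).
Qed.

Lemma L3_const f : L3 f -> f@_(mone : {fmonom nat}) = 0.
Proof.
have M (h h' : F) : (h * h')@_mone = h@_mone * h'@_mone by apply: rmorphM.
move: f; apply: L3_ind => [|f g f0 g0|i _].
- by split=> [|a f g f0 g0]; rewrite ?mcoeff0 // mcoeffD mcoeffZ f0 g0 mulr0 addr0.
- have E1 := M f g; have E2 := M g f; rewrite f0 g0 mulr0 in E1 E2.
  exact: etrans (mcoeffB _ _ _) (etrans (congr2 (fun a b => a - b) E1 E2) (subrr 0)).
- by rewrite mcoeffU fm1_eq1.
Qed.

End Homogeneous.

(** * Weights of words and straightening into regular words *)

Section Weights.
Variables (K : fieldType) (d : Order.disp_t) (I : orderType d) (e : I -> freeF K).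
Hypothesis e_basis : is_lie_basis e.
Local Notation F := (freeF K).
Implicit Types (i j k : I) (f g : F) (v : seq I).

Local Notation Lh := (lcomm (fun a => exists s : 'I_3, a = letter K s)).

Lemma lie_basis_hom i : hom (degF (e i)) (e i).
Proof. by apply: homogF_hom; apply: lie_basis_homog. Qed.

(** A basis element of degree zero would be a constant, hence zero by [L3_const], against
    independence. The predecessor in [wd] is therefore a true subtraction. *)
Lemma lie_basis_deg_gt0 i : (0 < degF (e i))%N.
Proof.
rewrite lt0n; apply/eqP => d0; have hi : homogF (e i) by apply: lie_basis_homog.
have e0 : e i = 0.
  apply/malgP => w; rewrite mcoeff0; case: (boolP (w \in msupp (e i))).
    move=> /hi; rewrite d0 => /size0nil w0.
    have -> : w = mone by apply/eqP; rewrite fmP w0 fm1.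
    exact: L3_const (lie_basis_L3i e_basis i).
  exact: mcoeff_outdom.
have : << i >> = 0 :> {malg K[I]}.
  apply: (lie_basis_free e_basis).
  by apply: etrans (lextU e i) _; rewrite e0; apply: esym (lext0 e).
by move/(congr1 (mcoeff i)); rewrite mcoeffUU mcoeff0 => /eqP; rewrite oner_eq0.
Qed.

Definition wd i := (degF (e i)).-1.
Definition wds v := (\sum_(i <- v) wd i)%N.

Lemma wds_cons i v : wds (i :: v) = (wd i + wds v)%N.
Proof. by rewrite /wds big_cons. Qed.

Lemma wds_cat u v : wds (u ++ v) = (wds u + wds v)%N.
Proof. by rewrite /wds big_cat. Qed.

Lemma word_wtE v : word_wt e v = (wds v)%:Z + 1.
Proof.
congr (_ + 1); elim: v => [|i v IH].
  by rewrite /wds !big_nil.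
rewrite wds_cons big_cons /= PoszD -IH -{1}(prednK (lie_basis_deg_gt0 i)) -/(wd i).
by move: (\sum_(j <- v) _) => s; rewrite !intS opprD !addrA addrAC; lia.
Qed.

Lemma lie_basis_lcomm i : Lh (wd i) (e i).
Proof.
have := hom_comp_L3 (degF (e i)) (lie_basis_L3i e_basis i).
by rewrite (hom_compE _ (lie_basis_hom i)) eqxx.
Qed.

Lemma word_val_lie_prod v : lie_prod (letter K) (size v) (wds v) (word_val e v).
Proof.
elim: v => [|i v IH]; first by rewrite /wds /word_val !big_nil; apply: lie_prod_nil.
rewrite wds_cons /word_val big_cons; apply: lie_prod_cons IH.
exact: lie_basis_lcomm.
Qed.

Lemma lie_basis_commr i j :
  span (fun g => exists2 k, wd k = (wd i + wd j).+1 & g = e k) (commr (e i) (e j)).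
Proof.
pose D := (degF (e i) + degF (e j))%N.
(* The commutator is homogeneous, so projecting its expansion to degree [D] discards the basis
   elements of every other degree. *)
have <- : hom_comp D (lext e (bracket e i j)) = commr (e i) (e j).
  rewrite (bracketK e_basis) (hom_compE D (D := D)) ?eqxx //.
  by apply: hom_commr; apply: lie_basis_hom.
rewrite (lext_comp _ (hom_comp_lin D)).
apply: (lext_closed (span_closed _)) => k _.
rewrite (hom_compE D (lie_basis_hom k)); case: eqP => [kD|_]; last exact: span_0.
apply: span_gen; exists k => //; rewrite /wd kD /D.
by have := lie_basis_deg_gt0 i; have := lie_basis_deg_gt0 j; lia.
Qed.

Lemma word_val_cat u v : word_val e (u ++ v) = word_val e u * word_val e v.
Proof. by rewrite /word_val big_cat. Qed.

Lemma word_val_cons i v : word_val e (i :: v) = e i * word_val e v.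
Proof. by rewrite /word_val big_cons. Qed.

Lemma word_val_nil : word_val e [::] = 1.
Proof. by rewrite /word_val big_nil. Qed.

(** Besides the weight bound [a], the number of factors is bounded by [p]: this makes straightening
    terminate. [wfilt] forgets [p]. *)
Definition wspan a p : F -> Prop :=
  span (fun g => exists v, [/\ (size v <= p)%N, (a <= wds v)%N & g = word_val e v]).

Lemma wspan_closed a p : lin_closed (wspan a p).
Proof. exact: span_closed. Qed.

Lemma wspan_word a p v : (size v <= p)%N -> (a <= wds v)%N -> wspan a p (word_val e v).
Proof. by move=> vp av; apply: span_gen; exists v. Qed.

Lemma wspanW a a' p p' f : (a' <= a)%N -> (p <= p')%N -> wspan a p f -> wspan a' p' f.
Proof.
move=> aa pp; move: f; apply: span_mono => g [v [vp av ->]]; exists v.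
by split=> //; [apply: leq_trans pp | apply: leq_trans av].
Qed.

Lemma wspanM a a' p p' f g :
  wspan a p f -> wspan a' p' g -> wspan (a + a') (p + p') (f * g).
Proof.
move=> Wf Wg; move: f Wf; apply: span_min.
  exact: (closed_preim (mul_linl g)) (wspan_closed _ _).
move=> _ [u [up au ->]]; move: g Wg; apply: span_min.
  exact: (closed_preim (mul_linr (@free_scalerAr K) _)) (wspan_closed _ _).
move=> _ [v [vp av ->]]; rewrite -word_val_cat; apply: wspan_word.
  by rewrite size_cat leq_add.
by rewrite wds_cat leq_add.
Qed.

Lemma wspan_commr1 u j :
  wspan (wds u + wd j).+1 (size u) (commr (word_val e u) (e j)).
Proof.
elim: u => [|i u IH].
  rewrite word_val_nil /commr mul1r mulr1 subrr; exact: span_0.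
rewrite word_val_cons commrMl wds_cons; apply: (closedD (wspan_closed _ _)).
  have -> : ((wd i + wds u + wd j).+1 = wd i + (wds u + wd j).+1)%N by lia.
  rewrite -[size _]add1n; apply: wspanM IH.
  have := @wspan_word (wd i) 1 [:: i]; rewrite word_val_cons word_val_nil mulr1.
  by apply; rewrite // /wds big_seq1.
have -> : ((wd i + wds u + wd j).+1 = (wd i + wd j).+1 + wds u)%N by lia.
rewrite -[size _]add1n; apply: wspanM (wspan_word (leqnn _) (leqnn _)).
move: (commr _ _) (lie_basis_commr i j); apply: span_min; first exact: wspan_closed.
move=> _ [k wk ->]; have := @wspan_word (wd k) 1 [:: k].
rewrite word_val_cons word_val_nil mulr1 wk; apply => //.
by rewrite /wds big_seq1 wk.
Qed.

Lemma wspan_commr_word u v : (0 < size u)%N ->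
  wspan (wds u + wds v).+1 (size u + size v).-1 (commr (word_val e u) (word_val e v)).
Proof.
move=> u0; elim: v => [|j v IH].
  rewrite word_val_nil /commr mul1r mulr1 subrr; exact: span_0.
rewrite word_val_cons commrMr wds_cons; apply: (closedD (wspan_closed _ _)).
  have -> : ((wds u + (wd j + wds v)).+1 = (wds u + wd j).+1 + wds v)%N by lia.
  rewrite /= addnS /=.
  exact: wspanM (wspan_commr1 _ _) (wspan_word (leqnn _) (leqnn _)).
have -> : ((wds u + (wd j + wds v)).+1 = wd j + (wds u + wds v).+1)%N by lia.
have -> : ((size u + size (j :: v)).-1 = 1 + (size u + size v).-1)%N by rewrite /=; lia.
apply: wspanM IH.
have := @wspan_word (wd j) 1 [:: j]; rewrite word_val_cons word_val_nil mulr1.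
by apply; rewrite // /wds big_seq1.
Qed.

Definition wfilt a : F -> Prop :=
  span (fun g => exists2 v, (a <= wds v)%N & g = word_val e v).

Lemma wfilt_closed a : lin_closed (wfilt a).
Proof. exact: span_closed. Qed.

Lemma wspan_wfilt a p f : wspan a p f -> wfilt a f.
Proof. by move: f; apply: span_mono => g [v [_ av ->]]; exists v. Qed.

Lemma wfiltM a a' f g : wfilt a f -> wfilt a' g -> wfilt (a + a') (f * g).
Proof.
move=> Wf Wg; move: f Wf; apply: span_min.
  exact: (closed_preim (mul_linl g)) (wfilt_closed _).
move=> _ [u au ->]; move: g Wg; apply: span_min.
  exact: (closed_preim (mul_linr (@free_scalerAr K) _)) (wfilt_closed _).
move=> _ [v av ->]; rewrite -word_val_cat; apply: span_gen; exists (u ++ v) => //.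
by rewrite wds_cat leq_add.
Qed.

Lemma wfilt_commr a a' f g : wfilt a f -> wfilt a' g -> wfilt (a + a').+1 (commr f g).
Proof.
move=> Wf Wg; move: f Wf; apply: span_min.
  exact: (closed_preim (commr_linl (@free_scalerAr K) _)) (wfilt_closed _).
move=> _ [u au ->]; move: g Wg; apply: span_min.
  exact: (closed_preim (commr_linr (@free_scalerAr K) _)) (wfilt_closed _).
move=> _ [v av ->]; case: u au => [|i u] au.
  rewrite word_val_nil /commr mul1r mulr1 subrr; exact: span_0.
have := @wspan_commr_word (i :: u) v isT; move/wspan_wfilt.
by apply: span_mono => h [w ww ->]; exists w => //; apply: leq_trans ww; rewrite ltnS leq_add.
Qed.

Lemma wfilt1 : wfilt 0 1.
Proof. by rewrite -word_val_nil; apply: span_gen; exists [::]. Qed.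

Lemma L3_wfilt f : L3 f -> wfilt 0 f.
Proof.
move=> /(L3_lincomb e_basis) [c <-]; apply: (lext_closed (wfilt_closed 0)) => i _.
by apply: span_gen; exists [:: i] => //; rewrite word_val_cons word_val_nil mulr1.
Qed.

Lemma F3_wfilt f : F3 f -> wfilt 0 f.
Proof.
move: f; apply: F3_ind; [exact: wfilt_closed|exact: wfilt1| |].
  by move=> f g; apply: (@wfiltM 0 0).
by move=> i i3; apply: L3_wfilt; apply: L3_fvar.
Qed.

Definition reg_span a : F -> Prop :=
  span (fun g => exists v, [/\ regular v, (a <= wds v)%N & g = word_val e v]).

Lemma wspan_perm u v : perm_eq u v ->
  wspan (wds v) (size v).-1 (word_val e v - word_val e u).
Proof.
move=> uv.
have [_ _ //] : [/\ size u = size v, wds u = wds v &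
    wspan (wds v) (size v).-1 (word_val e v - word_val e u)].
have vu : perm_eq v u by rewrite perm_sym.
(* Exchanges of adjacent blocks generate all permutations. Each changes the product by [[s1,s2]s3],
   of larger weight and expressible with one factor fewer. *)
pose P s := [/\ size s = size v, wds s = wds v &
    wspan (wds v) (size v).-1 (word_val e v - word_val e s)].
apply: (catCA_perm_ind (P := P)) vu _ => [s1 s2 s3|]; last first.
  by split=> //; rewrite subrr; apply: span_0.
case=> ss ws Ws; split.
- by rewrite -ss !size_cat addnCA.
- by rewrite -ws !wds_cat addnCA.
case: s1 ss ws Ws => [|i s1] ss ws Ws; first exact: Ws.
rewrite -(subrKA (word_val e ((i :: s1) ++ s2 ++ s3))).
apply: (closedD (wspan_closed _ _)) Ws _.
have -> : word_val e ((i :: s1) ++ s2 ++ s3) - word_val e (s2 ++ (i :: s1) ++ s3) =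
   commr (word_val e (i :: s1)) (word_val e s2) * word_val e s3.
  by rewrite !word_val_cat /commr mulrBl !mulrA.
move: ss ws; rewrite !size_cat !wds_cat => <- <-; rewrite !addnA.
apply: wspanW (wspanM (wspan_commr_word s2 _)
  (wspan_word (leqnn (size s3)) (leqnn (wds s3)))) => //; rewrite /=; lia.
Qed.

(** Sorting a word changes its value by a combination of shorter words of no smaller weight, so
    induction on length applies. *)
Lemma word_reg_span n v : (size v <= n)%N -> reg_span (wds v) (word_val e v).
Proof.
elim: n v => [|n IH] v vn.
  case: v vn => // _; rewrite word_val_nil; apply: span_gen; exists [::].
  by rewrite word_val_nil.
have sv : perm_eq (sort <=%O v) v by rewrite perm_sort.
rewrite -[word_val e v](subrK (word_val e (sort <=%O v))).
apply: (closedD (span_closed _)); last first.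
  apply: span_gen; exists (sort <=%O v); split=> //; first exact: sort_sorted le_total v.
  by rewrite /wds (perm_big _ sv).
move: (_ - _) (wspan_perm sv); apply: span_min; first exact: span_closed.
move=> _ [u [un wu ->]]; have {}un : (size u <= n)%N by move: un vn; lia.
by move: (IH u un); apply: span_mono => g [w [rw ww ->]]; exists w; split=> //; lia.
Qed.

Lemma wfilt_reg_span a f : wfilt a f -> reg_span a f.
Proof.
move: f; apply: span_min; first exact: span_closed.
move=> _ [v av ->]; move: (word_reg_span (leqnn (size v))).
by apply: span_mono => g [w [rw ww ->]]; exists w; split=> //; lia.
Qed.

Lemma reg_span_expansion a f : reg_span a f -> exists2 c : {malg K[seq I]},
  regular_expansion e f c & forall v, v \in msupp c -> (a <= wds v)%N.
Proof.
pose P g := exists2 c : {malg K[seq I]}, lext (word_val e) c = g &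
  forall v, v \in msupp c -> regular v /\ (a <= wds v)%N.
suff h : reg_span a f -> P f.
  by move=> /h[c Ec Hc]; exists c => [|v /Hc[]//]; split=> // v /Hc[].
move: f; apply: span_min => [|g [v [rv av ->]]]; last first.
  exists << v >>; first exact: lextU.
  by move=> w; rewrite msuppU oner_eq0 inE => /eqP ->.
split=> [|b f g [c Ec Hc] [c' Ec' Hc']].
  by exists 0; [exact: lext0|move=> v; rewrite msupp0 inE].
exists (b *: c + c'); first by rewrite -Ec -Ec'; apply: lext_lin.
move=> v /(fsubsetP (msuppD_le _ _)); rewrite inE => /orP[|]; last exact: Hc'.
by move=> /(fsubsetP (msuppZ_le _ _)); apply: Hc.
Qed.

Lemma regular_coeffsP f : F3 f -> regular_expansion e f (regular_coeffs e f).
Proof.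
move=> /F3_wfilt /wfilt_reg_span /reg_span_expansion [c Hc _].
by apply: xgetPex; exists c.
Qed.

(** Straightening yields some regular expansion of large weight, and uniqueness identifies it with
    the selected one. *)
Lemma regular_coeffs_wfilt a f : F3 f ->
  wfilt a f <-> (forall v, v \in msupp (regular_coeffs e f) -> (a <= wds v)%N).
Proof.
move=> Ff; split.
  move=> /wfilt_reg_span /reg_span_expansion [c Hc Wc].
  by rewrite -(regular_expansion_inj e_basis Hc (regular_coeffsP Ff)).
move=> h; have [_ <-] := regular_coeffsP Ff.
apply: (lext_closed (wfilt_closed a)) => v /h av.
by apply: span_gen; exists v.
Qed.

End Weights.

(** * T-ideals and the quotient algebra *)

Section TIdeal.
Variable K : fieldType.
Local Notation F := (freeF K).
Implicit Types (f g : F) (A : nat -> F).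

Lemma ideal_closed_lin (S : set F) : ideal_closed S -> lin_closed S.
Proof.
case=> [[S0 SB] SM]; move: S0; rewrite inE => S0.
have SB' h h' : S h -> S h' -> S (h - h').
  by move=> Sh Sh'; have := SB h h'; rewrite !inE; apply.
split=> // c f g Sf Sg; rewrite -[g]opprK; apply: (SB' (c *: f) (- g)); last first.
  by rewrite -sub0r; apply: SB'.
by move: Sf => /(SM c%:A f 1); rewrite mulr1 -scalerAl mul1r.
Qed.

Lemma Tn_closed n : lin_closed (@Tn K n).
Proof. by apply: ideal_closed_lin; apply: ideal_gen_closed. Qed.

Lemma Tn_lcommr (s : seq F) : Tn (size s) (lcommr s).
Proof. by move=> S [_]; apply; exists s. Qed.

Lemma Tn_ind n (P : F -> Prop) : lin_closed P ->
  (forall f g h, P g -> P (f * g * h)) ->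
  (forall s : seq F, size s = n -> P (lcommr s)) -> forall f, Tn n f -> P f.
Proof.
move=> cP PM PC f; apply; split; last by move=> _ [s sn ->]; apply: PC.
by split=> //; apply: zmod_closedP.
Qed.

(** Substitutions send commutators to commutators of the same length; this is what turns membership
    in [Tn n] into an identity of the quotient. *)
Lemma Tn_evalm n A f : Tn n f -> Tn n (evalm A f).
Proof.
move: f; apply: Tn_ind => [|f g h Tg|s <-].
- exact: (closed_preim (evalm_lin A)) (Tn_closed n).
- rewrite !(evalmM (@free_scalerAr K)).
  by have [_ TM] := ideal_gen_closed [set g | exists2 s : seq F, size s = n & g = lcommr s]; apply: TM.
have -> : evalm A (lcommr s) = lcommr [seq evalm A g | g <- s].
  case: s => [|a s] /=; first exact: lext0.
  elim: s a => //= b s IH a; rewrite IH.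
  by rewrite (evalm_commr (@free_scalerAr K)).
by rewrite -(size_map (evalm A)); apply: Tn_lcommr.
Qed.

Lemma idc_Tn k f : idc k f -> Tn k.+1 f.
Proof.
move: f; apply: idc_ind; first exact: Tn_closed.
move=> a l Ll; rewrite -[a * l]mulr1.
have [_ TM] := ideal_gen_closed [set g | exists2 s : seq F, size s = k.+1 & g = lcommr s].
apply: TM; move: l Ll.
suff h l : lcomm (fun _ => True) k l ->
    span (fun g => exists2 s : seq F, size s = k.+1 & g = lcommr s) l.
  move=> l /h; apply: (span_min (Tn_closed k.+1)) => _ [s <- ->].
  exact: Tn_lcommr.
elim: k l => [|k IH] l.
  by move=> _; apply: span_gen; exists [:: l].
move: l; apply: lcommS_ind => [|l b /IH sl _]; first exact: span_closed.
move: l sl; apply: span_min.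
  exact: (closed_preim (commr_linl (@free_scalerAr K) _)) (span_closed _).
move=> _ [[|a' s] //= [ss] ->]; apply: span_gen; exists (a' :: rcons s b).
  by rewrite /= size_rcons ss.
by rewrite /= -cats1 foldl_cat.
Qed.

(** A retraction of F onto [F3], killing the other variables. It brings the generators of [Tn n],
    which involve all variables, into the reach of weights. *)
Definition restrict3 : F -> F := evalm (fun i => if (i < 3)%N then fvar K i else 0).

Lemma restrict3_id f : F3 f -> restrict3 f = f.
Proof.
move: f; apply: F3_ind => [||f g Ef Eg|i i3].
- split=> [|c f g Ef Eg]; first exact: lext0.
  by rewrite /restrict3 evalm_lin -/(restrict3 _) Ef -/(restrict3 _) Eg.
- exact: evalm1.
- by rewrite /restrict3 (evalmM (@free_scalerAr K)) -!/(restrict3 _) Ef Eg.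
- by apply: etrans (evalmU _ i) _; rewrite i3.
Qed.

Section RelativelyFree.
Variable n : nat.
Local Notation pi := (\pi_(Fn K n) : F -> Fn K n).

Lemma pi_eq0 f : (pi f = 0) <-> Tn n f.
Proof.
have E0 : 0 = pi 0 by rewrite -(subrr (pi 0)) -Fn_piB subrr.
rewrite E0; split=> [/eqP|Tf]; last apply/eqP.
  by rewrite Fn_piE subr0 inE.
by rewrite Fn_piE subr0 inE.
Qed.

Lemma evalFn_pi A f : evalFn (fun i => pi (A i)) f = pi (evalm A f).
Proof.
have pi0 : pi 0 = 0 by apply/pi_eq0; apply: closed0 (Tn_closed n).
rewrite /evalFn /evalm /lext (big_morph pi (@Fn_piD K n) pi0).
apply: eq_bigr => w _; rewrite Fn_piZ; congr (_ *: _).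
by rewrite (big_morph pi (@Fn_piM K n) (erefl : pi 1 = 1)).
Qed.

Lemma identityFn_Tn f : F3 f -> identityFn n f <-> Tn n f.
Proof.
move=> Ff; split=> [idf|Tf a b c].
  apply/pi_eq0; rewrite -{1}(restrict3_id Ff) -evalFn_pi.
  have pi0 : pi 0 = 0 by apply/pi_eq0; apply: closed0 (Tn_closed n).
  (* The identity is tested on the classes of [x, y, z]. From index 3 on, the default of [nth] and
     [restrict3] both give zero. *)
  rewrite -(idf (pi (fvar K 0)) (pi (fvar K 1)) (pi (fvar K 2))).
  apply: eq_bigr => w _; congr (_ *: _); apply: eq_bigr => i _.
  by case: i => [|[|[|i]]] //=; rewrite nth_nil.
have -> : evalFn (nth 0 [:: a; b; c]) f =
    evalFn (fun i => pi (repr (nth 0 [:: a; b; c] i))) f.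
  apply: eq_bigr => w _; congr (_ *: _); apply: eq_bigr => i _.
  by rewrite reprK.
by rewrite evalFn_pi; apply/pi_eq0; apply: Tn_evalm.
Qed.

End RelativelyFree.
End TIdeal.

(** * Comparison of the T-ideals with the weight filtration *)

Section Main.
Variables (K : fieldType) (d : Order.disp_t) (I : orderType d) (e : I -> freeF K).
Hypothesis e_basis : is_lie_basis e.
Implicit Types f : freeF K.

Lemma restrict3_wfilt f : wfilt e 0 (restrict3 f).
Proof.
move: f; apply: malg_ind => [|w].
  exact: (closed_preim (evalm_lin _)) (wfilt_closed _ _).
rewrite /restrict3 /evalm lextU; elim/big_ind: _ => [|f g|i _].
- exact: wfilt1.
- exact: (@wfiltM _ _ _ e 0 0).
case: ifP => i3; last exact: closed0 (wfilt_closed _ _).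
by apply: (L3_wfilt e_basis); apply: L3_fvar.
Qed.

(** Stated for [restrict3 f], the claim makes sense on all of F and passes through the generation of
    the ideal; each further bracket raises the filtration by one. *)
Lemma Tn_wfilt n f : F3 f -> Tn n.+1 f -> wfilt e n f.
Proof.
move=> Ff Tf; rewrite -(restrict3_id Ff); move: {Ff} f Tf.
apply: Tn_ind => [|f g h Wg|[|a s] //= [<-]].
- exact: (closed_preim (evalm_lin _)) (wfilt_closed _ _).
- rewrite /restrict3 !(evalmM (@free_scalerAr K)) -!/(restrict3 _) -[n]addn0.
  apply: (wfiltM _ (restrict3_wfilt h)); rewrite -[n]add0n.
  exact: (wfiltM (restrict3_wfilt f) Wg).
elim/last_ind: s => [|s b IH]; first exact: restrict3_wfilt.
rewrite -cats1 foldl_cat size_cat addn1 /=.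
rewrite /restrict3 (evalm_commr (@free_scalerAr K)) -!/(restrict3 _) -[size s]addn0.
exact: (wfilt_commr e_basis IH (restrict3_wfilt b)).
Qed.

Lemma wfilt_Tn n f : 2%:R != 0 :> K -> 3%:R != 0 :> K -> wfilt e n f -> Tn n.+1 f.
Proof.
move=> K2 K3; move: f; apply: span_min; first exact: Tn_closed.
move=> _ [v nv ->]; apply: idc_Tn.
have := lie_prod_idc (@free_scalerAr K) K2 K3 (word_val_lie_prod e_basis v).
by rewrite -(subnK nv); elim: (_ - n)%N => // k IH; rewrite addSn => /(idc_pred (@free_scalerAr K)) /IH.
Qed.

Lemma wt_geP n f : (n.+1%:Z%:E <= wt e f)%E <->
  (forall v, v \in msupp (regular_coeffs e f) -> (n <= wds e v)%N).
Proof.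
have E v : (n.+1%:Z%:E <= (word_wt e v)%:E)%E = (n <= wds e v)%N.
  by rewrite lee_fin (word_wtE e_basis); lia.
suff h (s : seq (seq I)) :
    (n.+1%:Z%:E <= \big[Order.min/+oo%E]_(v <- s) (word_wt e v)%:E)%E <->
    (forall v, v \in s -> (n <= wds e v)%N) by exact: h (msupp (regular_coeffs e f)).
elim: s => [|v s IH]; first by rewrite big_nil leey; split=> // _ v; rewrite in_nil.
rewrite big_cons le_min E; split.
  move=> /andP[nv /IH h] u; rewrite inE => /orP[/eqP -> //|]; exact: h.
move=> h; rewrite h ?mem_head //=; apply/IH => u us; apply: h.
by rewrite inE us orbT.
Qed.

End Main.

Theorem mainTheorem2 (K : fieldType) (K_infinite : infinite_set [set: K])
    (charK_neq2 : 2%N \notin [pchar K]) (charK_neq3 : 3%N \notin [pchar K])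
    (d : Order.disp_t) (I : orderType d) (e : I -> freeF K)
    (e_basis : is_lie_basis e)
    (n : nat) (n_ge3 : (3 <= n)%N) (f : freeF K) (f_in_F3 : F3 f) :
  (identityFn n f <-> (n%:Z%:E <= wt e f)%E) /\ (identityFn n f <-> Tn n f).
Proof.
have K2 : 2%:R != 0 :> K by move: charK_neq2; rewrite inE.
have K3 : 3%:R != 0 :> K by move: charK_neq3; rewrite inE.
split; last exact: identityFn_Tn.
(* The exponent becomes a successor because the weight of a word is [wds] plus one: [Tn n.+1]
   corresponds to [wfilt e n]. *)
case: n n_ge3 => // n _; split.
  move=> /(identityFn_Tn _ f_in_F3) /(Tn_wfilt e_basis f_in_F3).
  by move=> /(regular_coeffs_wfilt e_basis _ f_in_F3) /(wt_geP e_basis).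
move=> /(wt_geP e_basis) /(regular_coeffs_wfilt e_basis _ f_in_F3).
by move=> /(wfilt_Tn e_basis K2 K3) /(identityFn_Tn _ f_in_F3).
Qed.
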